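(* Let $a$ be a positive integer, let $h$ be a positive integer dividing $a$, let $\varepsilon > 0$, and let $R = \mathbb{Z}/a\mathbb{Z}$. For each positive integer $n$, let $C_n$ be a deterministic $n\times n$ alternating matrix with entries in $R$ all divisible by $h$, and let $X_n$ be a random $C_n$-symmetric $n\times n$ matrix over $R$ with entries on and above the diagonal independent and $\varepsilon$-balanced. Let $p$ be a prime dividing $a/h$. If the rank of $C_n/h$ mod $p$ is bounded (as $n$ varies), then $$\liminf_{n\to\infty} \mathbb{E}\left[\#\operatorname{Sur}\left(\operatorname{coker}(X_n), (\mathbb{Z}/hp\mathbb{Z})^2\right)\right] > \left|\wedge^2 \left((\mathbb{Z}/hp\mathbb{Z})^2[h]\right)\right|.$$
   Context: An $n\times n$ matrix $C$ over a commutative ring $R$ is alternating if $C^{\intercal} = -C$ and all its diagonal entries are $0$. For an alternating $C$, an $n\times n$ matrix $X$ over $R$ is called $C$-symmetric if $X - X^{\intercal} = C$. A random variable $N$ valued in a ring $R$ is $\varepsilon$-balanced if for every maximal ideal $\mathfrak{p}$ of $R$ and every residue class $r \in R/\mathfrak{p}$ one has $\mathbb{P}[N \equiv r \pmod{\mathfrak{p}}] \leq 1-\varepsilon$. For an $n\times n$ matrix $M$ over $R$, $\operatorname{coker}(M) = R^n/M(R^n)$. $\operatorname{Sur}(A,G)$ is the set of surjective group homomorphisms $A\to G$. $G[h]$ is the subgroup of elements of $G$ of order dividing $h$, and $\wedge^2$ is the exterior square over $\mathbb{Z}$. The matrix $C_n/h$ is well defined as a matrix over $\mathbb{Z}/(a/h)\mathbb{Z}$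 (via the isomorphism $\mathbb{Z}/(a/h)\mathbb{Z} \to hR$ given by multiplication by $h$), and since $p \mid a/h$ it can be reduced modulo $p$ to a matrix over $\mathbb{F}_p$; ''the rank of $C_n/h$ mod $p$'' is the rank of that matrix over $\mathbb{F}_p$. *)

(* Defs.v *)
From HB Require Import structures.
From mathcomp Require Import all_boot all_order all_algebra.
From mathcomp Require Import all_classical all_reals all_analysis.

Set Implicit Arguments.
Unset Strict Implicit.
Unset Printing Implicit Defensive.

Import Order.TTheory GRing.Theory Num.Theory.

Local Open Scope classical_set_scope.
Local Open Scope ring_scope.

Definition alternating_mx (R : nzRingType) (n : nat) (C : 'M[R]_n) : Prop :=
  C^T = - C /\ forall i, C i i = 0.

Definition Csymmetric (R : nzRingType) (n : nat) (C X : 'M[R]_n) : Prop :=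
  X - X^T = C.

(* [idealr_closed] includes properness (1 \notin I). *)
Definition maximal_ideal (R : finComNzRingType) (I : {set R}) : Prop :=
  idealr_closed I /\
  forall J : {set R}, idealr_closed J -> I \subset J -> J = I.

(* Random variables with values in a finite type carrying the discrete
   sigma-algebra. *)
Definition discrete_rv (d : measure_display) (Omega : measurableType d)
    (V : finType) (Y : Omega -> V) : Prop :=
  forall v, measurable (Y @^-1` [set v]).

Definition balanced (K : realType) (d : measure_display)
    (Omega : measurableType d) (P : probability Omega K)
    (R : finComNzRingType) (eps : K) (N : Omega -> R) : Prop :=
  forall (I : {set R}) (r : R), maximal_ideal I ->
    (P [set w | (N w - r)%R \in I] <= (1 - eps)%:E)%E.

Definition mutually_independent (K : realType) (d : measure_display)
    (Omega : measurableType d) (P : probability Omega K)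
    (I V : finType) (D : {set I}) (Y : I -> Omega -> V) : Prop :=
  forall (S : {set I}) (E : I -> {set V}), S \subset D ->
    P [set w | forall k, k \in S -> Y k w \in E k] =
    (\prod_(k in S) P [set w | Y k w \in E k])%E.

Definition upper_indices (n : nat) : {set 'I_n * 'I_n} :=
  [set ij : 'I_n * 'I_n | (ij.1 <= ij.2)%N]%SET.

Section Cokernel.
Variables (R : finComNzRingType) (n : nat) (M : 'M[R]_n).

Definition mximage : {pred 'cV[R]_n} :=
  [pred v | [exists u : 'cV[R]_n, v == M *m u]].

Fact mximage_zmod_closed : zmod_closed mximage.
Proof.
split; first by apply/existsP; exists 0; rewrite mulmx0.
move=> _ _ /existsP[u /eqP->] /existsP[v /eqP->].
by apply/existsP; exists (u - v); rewrite mulmxBr.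
Qed.

HB.instance Definition _ :=
  GRing.isZmodClosed.Build 'cV[R]_n mximage mximage_zmod_closed.

Definition coker : Type := Quotient.quot mximage.
HB.instance Definition _ := GRing.Zmodule.on coker.
HB.instance Definition _ := [Countable of coker by <:%/].
HB.instance Definition _ :=
  fintype.isFinite.Build coker (pcan_enumP (can_pcan (fun x : coker => reprK x))).

End Cokernel.

Definition Sur (A G : finZmodType) : {set {ffun A -> G}} :=
  [set f : {ffun A -> G} |
    [forall x, forall y, f (x + y) == f x + f y] &&
    [forall y, exists x, f x == y]]%SET.

(* (Z/m)^2, for m > 1. *)
Definition Zsquare (m : nat) : Type := ('Z_m * 'Z_m)%type.
HB.instance Definition _ (m : nat) := GRing.Zmodule.on (Zsquare m).
HB.instance Definition _ (m : nat) := Finite.on (Zsquare m).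

Section Torsion.
Variables (A : finZmodType) (h : nat).

Definition tors_pred : {pred A} := [pred x | x *+ h == 0].

Fact tors_zmod_closed : zmod_closed tors_pred.
Proof.
split=> [|x y]; first by rewrite inE mul0rn.
by rewrite !inE mulrnBl => /eqP-> /eqP->; rewrite subr0.
Qed.

HB.instance Definition _ :=
  GRing.isZmodClosed.Build A tors_pred tors_zmod_closed.

(* A[h] as an abelian group. *)
Record torsion : Type :=
  Torsion { torsion_val : A; _ : torsion_val \in tors_pred }.

HB.instance Definition _ := [isSub for torsion_val].
HB.instance Definition _ := [Finite of torsion by <:].
HB.instance Definition _ := [SubChoice_isSubZmodule of torsion by <:].

End Torsion.

(* The exterior square over Z: the free abelian group on A x A modulo the
   subgroup generated by the bilinearity relations and the a /\ a. *)
Section ExteriorSquare.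
Variable A : finZmodType.

Let F := {ffun A * A -> int}.

Definition freegen (a b : A) : F := [ffun xy => (xy == (a, b))%:R].

Definition wedge_relations : set F :=
  [set f | exists a b c, f = freegen (a + b) c - freegen a c - freegen b c] `|`
  [set f | exists a b c, f = freegen c (a + b) - freegen c a - freegen c b] `|`
  [set f | exists a, f = freegen a a].

Definition is_subgroup (N : set F) : Prop :=
  N 0 /\ forall x y, N x -> N y -> N (x - y).

Definition wedge_kernel : {pred F} :=
  [pred f | `[< smallest is_subgroup wedge_relations f >]].

Fact wedge_kernel_zmod_closed : zmod_closed wedge_kernel.
Proof.
split=> [|x y]; first by rewrite inE => N [[N0 _] _].
rewrite !inE => Nx Ny N NP.
by apply: NP.1.2; [exact: Nx | exact: Ny].
Qed.

HB.instance Definition _ :=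
  GRing.isZmodClosed.Build F wedge_kernel wedge_kernel_zmod_closed.

Definition exterior_square : Type := Quotient.quot wedge_kernel.
HB.instance Definition _ := GRing.Zmodule.on exterior_square.

End ExteriorSquare.

(* The inverse of multiplication by h from Z/(a/h) onto h(Z/a), for h | a and
   1 < a/h; see [divZpK].  Values outside h(Z/a) are irrelevant. *)
Definition divZp (a h : nat) (c : 'Z_a) : 'Z_(a %/ h) := ((c : nat) %/ h)%:R.

Lemma divZpK (a h : nat) (x : 'Z_(a %/ h)) : (0 < a)%N -> (h %| a)%N ->
  (1 < a %/ h)%N -> divZp h ((h * x)%:R : 'Z_a) = x.
Proof.
move=> a0 ha ah1; have h0 : (0 < h)%N by exact: dvdn_gt0 ha.
have a1 : (1 < a)%N by apply: leq_trans ah1 (leq_div _ _).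
have xlt : (x < a %/ h)%N by rewrite -[X in (_ < X)%N](Zp_cast ah1) ltn_ord.
apply: val_inj; rewrite /divZp /= val_Zp_nat // val_Zp_nat //.
rewrite (@modn_small (h * x) a) ?mulKn ?modn_small //.
by rewrite -[X in (_ < X)%N](divnK ha) mulnC ltn_mul2r h0.
Qed.

Definition divmx (a h n : nat) (C : 'M['Z_a]_n) : 'M['Z_(a %/ h)]_n :=
  map_mx (@divZp a h) C.

(* Reduction modulo a prime p dividing m. *)
Definition reduce_mx (m p n : nat) (C : 'M['Z_m]_n) : 'M['F_p]_n :=
  map_mx (fun x : 'Z_m => (x : nat)%:R : 'F_p) C.

(* Main.v *)
Require Import Defs.
From HB Require Import structures.
From mathcomp Require Import all_boot all_order all_algebra.
From mathcomp Require Import all_classical all_reals all_analysis.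
From mathcomp Require Import measurable_realfun cyclic separable cyclotomic complex.
From mathcomp Require Import zify ring lra.

(** Put m = hp and G = (Z/m)^2.  A surjection from coker X to G is a surjective map
    f from (Z/a)^n to G with f X = 0, encoded by the images f_i of the basis vectors, or
    by its two rows f1 and f2.  So the moment is the sum of P (f X = 0) over such f, and
    for a lower bound it is enough to keep the rich ones, for which (1, 0) and (0, 1)
    each occur among the f_i a number of times proportional to n.  All but an
    exponentially small proportion of the maps are rich ([card_not_rich]).

    Fourier inversion writes P (f X = 0) as m^(-2n) times the sum over c in G^n of the
    expectation of e (sum_j c_j . (f X)_j), where e is a faithful character of Z/m
    ([fourier_kills]).  Through X - X^T = C the exponent becomes an affine function of
    the independent entries on and above the diagonal: X_ij has coefficient
    c_j . f_i + c_i . f_j, and X_ii has coefficient c_i . f_i ([pairing_symfill]).  Every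
    nonzero coefficient costs a factor less than 1 that depends only on eps and m
    ([balanced_zchar]).

    The coefficients all vanish for the m special characters c_i = lam (f_i2, - f_i1).
    They contribute e (lam f1 C f2^T), hence m altogether if f1 C f2^T = 0 in Z/m.  For
    any other c, compare c with the linear function of f that agrees with it most often
    on the positions of (1, 0) and (0, 1): the number of nonzero coefficients is at least
    proportional to n times the number of disagreements ([exists_defect]), and if there
    are none it is still proportional to n ([defect0_special]).  This is enough to beat
    the number of such c, so the remaining characters are negligible ([sum_nonspecial]),
    and P (f X = 0) is close to m^(1 - 2n) whenever f is rich and f1 C f2^T = 0
    ([kills_lower]).

    It remains to count the latter maps.  As C is a multiple of h, the values of
    f1 C f2^T lie in a group of order p, so that for each f1 at least a proportion 1/p of
    the f2 is suitable; but if f1 is in the kernel of C/h mod p, every f2 is.  When this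
    matrix has rank at most B, that happens for a proportion at least p^(-B) of the f1
    ([card_cross]).  The liminf is therefore at least
      hp (1/p + p^(-B) (1 - 1/p)) = h + h (p - 1) p^(-B) > h.
    On the other hand G[h] is generated by two elements and killed by h, so its exterior
    square is cyclic of order at most h ([counting_wedge_torsion]). *)

Set Implicit Arguments.
Unset Strict Implicit.
Unset Printing Implicit Defensive.

Import Order.TTheory GRing.Theory Num.Theory.

Local Open Scope ring_scope.

(** * Additive characters of Z/m *)

Lemma prim_root_exists (L : numClosedFieldType) (m : nat) :
  (0 < m)%N -> exists z : L, m.-primitive_root z.
Proof.
move=> m0; pose q : {poly L} := 'X^m - 1.
have [r qE] := closed_field_poly_normal q.
have q_monic : lead_coef q = 1 by exact/monicP/monicXnsubC.
rewrite q_monic scale1r in qE.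
have q_size : size q = m.+1 by rewrite size_XnsubC.
have r_uniq : uniq r.
  by rewrite -separable_prod_XsubC -qE separable_Xn_sub_1 // pnatr_eq0 -lt0n.
have r_size : size r = m by apply/eqP; rewrite -eqSS -q_size qE size_prod_XsubC.
have r_unity : all m.-unity_root r.
  by apply/allP=> x xr; rewrite /root_of_unity -/q qE root_prod_XsubC.
have /hasP[z _ zP] := has_prim_root m0 r_unity r_uniq (eq_leq (esym r_size)).
by exists z.
Qed.

Section Character.
Local Open Scope complex_scope.
Variables (K : rcfType) (m : nat) (m_gt1 : (1 < m)%N) (z : K[i]).
Hypothesis z_prim : m.-primitive_root z.

Definition zchar (x : 'Z_m) : K[i] := z ^+ x.

Lemma zchar0 : zchar 0 = 1. Proof. by []. Qed.

Lemma zcharD x y : zchar (x + y) = zchar x * zchar y.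
Proof.
rewrite /zchar -exprD -[RHS](prim_expr_mod z_prim).
by congr (_ ^+ (_ %% _)%N); exact: Zp_cast.
Qed.

Lemma zchar_sum (I : Type) (r : seq I) (Q : pred I) (g : I -> 'Z_m) :
  zchar (\sum_(i <- r | Q i) g i) = \prod_(i <- r | Q i) zchar (g i).
Proof. exact: (big_morph zchar zcharD zchar0). Qed.

Lemma zchar_eq1 x : (zchar x == 1) = (x == 0).
Proof.
rewrite /zchar -(prim_order_dvd z_prim) -(inj_eq val_inj) /=.
have xm : (x < m)%N by rewrite -[X in (_ < X)%N](Zp_cast m_gt1) ltn_ord.
apply/idP/idP => [|/eqP->]; last exact: dvdn0.
by rewrite /dvdn modn_small.
Qed.

Lemma norm_zchar x : `|zchar x| = 1.
Proof.
have m0 := prim_order_gt0 z_prim.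
apply/eqP; rewrite normrX; suff -> : `|z| = 1 by rewrite expr1n.
by apply/eqP; rewrite -(pexpr_eq1 m0) // -normrX (prim_expr_order z_prim) normr1.
Qed.

Lemma zchar_conj x : (zchar x)^* = zchar (- x).
Proof.
have nz : zchar x != 0 by rewrite -normr_eq0 norm_zchar oner_eq0.
apply: (mulfI nz); rewrite -zcharD subrr zchar0.
by rewrite -sqr_normc norm_zchar expr1n.
Qed.

(** Translating the summation index multiplies the sum by [zchar y], so the sum
    vanishes as soon as [zchar y] is not 1. *)
Lemma sum_zchar (y : 'Z_m) : \sum_(x : 'Z_m) zchar (x * y) = (m * (y == 0))%:R.
Proof.
have cardm : #|'Z_m| = m by rewrite card_ord Zp_cast.
have [->|y0] := eqVneq y 0.
  under eq_bigr do rewrite mulr0 zchar0.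
  by rewrite sumr_const cardm muln1.
rewrite muln0; set S := (LHS).
have : S = zchar y * S.
  rewrite {1}/S (reindex_inj (addIr 1)) /= mulr_sumr.
  by apply: eq_bigr => x _; rewrite mulrDl mul1r zcharD mulrC.
move/eqP; rewrite -subr_eq0 -{1}[S]mul1r -mulrBl mulf_eq0 subr_eq0 eq_sym.
by rewrite zchar_eq1 (negPf y0) => /eqP.
Qed.

Definition dot (u v : 'Z_m * 'Z_m) : 'Z_m := u.1 * v.1 + u.2 * v.2.

Lemma sum_zchar_dot (v : 'Z_m * 'Z_m) :
  \sum_(u : 'Z_m * 'Z_m) zchar (dot u v) = (m ^ 2 * (v == 0))%:R.
Proof.
rewrite -(pair_bigA _ (fun x y => zchar (dot (x, y) v))) /=.
under eq_bigr do (under eq_bigr do rewrite zcharD; rewrite -mulr_sumr sum_zchar).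
rewrite -mulr_suml sum_zchar -natrM; congr _%:R.
by case: v => v1 v2 /=; rewrite -[_ == 0 :> _ * _]/((v1 == 0) && (v2 == 0));
   case: (v1 == 0); case: (v2 == 0); rewrite /= ?muln0 ?mul0n ?muln1.
Qed.

(** The finitely many values other than 1 stay away from 1 on the unit circle;
    this gap is what turns a lack of concentration into a decay of Fourier
    coefficients. *)
Lemma Re_zchar_gap : exists2 kappa : K, 0 < kappa &
  forall x, x != 0 -> complex.Re (zchar x) <= 1 - kappa.
Proof.
have Re_le1 x : complex.Re (zchar x) <= 1.
  rewrite -lecR rmorph1 -(norm_zchar x); apply: le_trans (normc_ge_Re _).
  by rewrite lecR ler_norm.
have Re_geN1 x : -1 <= complex.Re (zchar x).
  have : `|complex.Re (zchar x)|%:C <= 1%:C by rewrite rmorph1 -(norm_zchar x) normc_ge_Re.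
  by rewrite lecR ler_norml => /andP[].
have Re_lt1 x : x != 0 -> complex.Re (zchar x) < 1.
  move=> x0; rewrite lt_neqAle Re_le1 andbT; apply: contra_neq x0 => Re1.
  have sum1 : complex.Re (zchar x) ^+ 2 + complex.Im (zchar x) ^+ 2 = 1.
    by apply: complexI; rewrite add_Re2_Im2 norm_zchar expr1n rmorph1.
  have Im0 : complex.Im (zchar x) = 0.
    by apply/eqP; rewrite -sqrf_eq0; apply/eqP; move: sum1; rewrite Re1; lra.
  by apply/eqP; rewrite -zchar_eq1 eq_complex Re1 Im0 /= !eqxx.
(* Each factor lies in ]0, 1], so the product is a lower bound for all of them
   at once. *)
exists (\prod_(x : 'Z_m | x != 0) ((1 - complex.Re (zchar x)) / 2)).
  by apply: prodr_gt0 => x /Re_lt1 h; rewrite divr_gt0 ?subr_gt0.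
move=> x x0; rewrite lerBrDr -lerBrDl (bigD1 x) //=.
have h0 y : 0 <= 1 - complex.Re (zchar y) by rewrite subr_ge0.
have P1 : \prod_(i : 'Z_m | (i != 0) && (i != x)) ((1 - complex.Re (zchar i)) / 2) <= 1.
  apply: prodr_ile1 => y _; rewrite divr_ge0 //= ler_pdivrMr //.
  by have := Re_geN1 y; lra.
apply: le_trans (ler_piMr _ P1) _; first by rewrite divr_ge0.
by rewrite ler_pdivrMr // ler_peMr // ler1n.
Qed.

(** The squared modulus of the Fourier coefficient is the mean of
    [zchar (g x - g y)] over two independent copies x and y.  By hypothesis
    g x and g y differ with probability at least eps, and then the real part
    loses [kappa]; hence it is at most 1 - kappa * eps.  The bound is stated
    with a square because later counts run over ordered pairs of indices, which
    see every off-diagonal entry twice. *)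
Lemma balanced_zchar (eps : K) : 0 < eps -> exists2 sigma : K, 0 <= sigma < 1 &
  forall (T : finType) (mu : T -> K) (g : T -> 'Z_m),
  (forall x, 0 <= mu x) -> \sum_x mu x = 1 ->
  (forall y, \sum_(x | g x == g y) mu x <= 1 - eps) ->
  `|\sum_x (mu x)%:C * zchar (g x)| <= (sigma ^+ 2)%:C.
Proof.
move=> eps0; have [kappa k0 gap] := Re_zchar_gap.
exists (Num.sqrt (Num.sqrt (1 - kappa * eps))).
  have h1 : 1 - kappa * eps < 1 by rewrite gtrDl oppr_lt0 mulr_gt0.
  by rewrite sqrtr_ge0 /= -[ltRHS]sqrtr1 ltr_sqrt // -[ltRHS]sqrtr1 ltr_sqrt.
move=> T mu g mu0 mu1 bal; rewrite sqr_sqrtr ?sqrtr_ge0 //.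
set S := \sum_x _.
have normS : `|S| = (complex.Re `|S|)%:C by rewrite RRe_real ?normr_real.
have Sge0 : 0 <= complex.Re `|S| by rewrite -ler0c -normS.
rewrite normS lecR -[leLHS]ger0_norm // -sqrtr_sqr ler_wsqrtr //.
have -> : complex.Re `|S| ^+ 2 = complex.Re (`|S| ^+ 2).
  by rewrite normS -rmorphXn.
have -> : `|S| ^+ 2 = \sum_x \sum_y (mu x * mu y)%:C * zchar (g x - g y).
  rewrite sqr_normc rmorph_sum /= mulr_suml; apply: eq_bigr => x _.
  rewrite mulr_sumr; apply: eq_bigr => y _.
  have -> : ((mu y)%:C * zchar (g y))^* = (mu y)%:C * zchar (- g y).
    by rewrite rmorphM -zchar_conj; congr (_ * _); exact: conjc_real.
  by rewrite rmorphM zcharD mulrACA.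
have ReD : {morph (@complex.Re K) : x y / x + y} by move=> [? ?] [? ?].
rewrite (big_morph _ ReD (erefl : complex.Re 0 = 0)).
have Re_term x y : complex.Re ((mu x * mu y)%:C * zchar (g x - g y)) <=
    mu x * (mu y * (1 - kappa * (g y != g x)%:R)).
  have -> c w : complex.Re (c%:C * w) = c * complex.Re w.
    by case: w => a b /=; rewrite mul0r subr0.
  rewrite -mulrA ler_wpM2l // ler_wpM2l //.
  have [->|ne] := eqVneq (g y) (g x); first by rewrite subrr zchar0 mulr0 subr0.
  by rewrite mulr1 gap // subr_eq0 eq_sym.
have inner x : \sum_y (mu y * (1 - kappa * (g y != g x)%:R)) <= 1 - kappa * eps.
  have -> : \sum_y (mu y * (1 - kappa * (g y != g x)%:R)) =
      1 - kappa * (1 - \sum_(y | g y == g x) mu y).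
    under eq_bigr do rewrite mulrBr mulr1.
    rewrite big_split /= mu1 sumrN; congr (1 - _).
    rewrite -[X in kappa * (X - _)]mu1.
    rewrite [X in kappa * (X - _)](bigID (fun y => g y == g x)) /= addrAC subrr add0r.
    rewrite mulr_sumr [RHS]big_mkcond; apply: eq_bigr => y _.
    by case: eqVneq; rewrite ?mulr0 ?mulr1 // mulrC.
  rewrite lerD2l lerN2 ler_wpM2l ?(ltW k0) // lerBrDl -lerBrDr; exact: bal.
have sum_le : \sum_x complex.Re (\sum_y (mu x * mu y)%:C * zchar (g x - g y)) <=
    \sum_x mu x * (1 - kappa * eps).
  apply: ler_sum => x _; rewrite (big_morph _ ReD (erefl : complex.Re 0 = 0)).
  apply: le_trans (ler_sum _ (fun y _ => Re_term x y)) _.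
  by rewrite -mulr_sumr ler_wpM2l.
by rewrite -mulr_suml mu1 mul1r in sum_le.
Qed.

End Character.

(** * Residues modulo a and modulo a divisor of a *)

Section Reduction.
Variables (a m : nat) (a_gt0 : (0 < a)%N) (m_gt1 : (1 < m)%N) (m_dvd_a : (m %| a)%N).

Definition red (x : 'Z_a) : 'Z_m := (x : nat)%:R.

Let a_gt1 : (1 < a)%N.
Proof. exact: leq_trans m_gt1 (dvdn_leq a_gt0 m_dvd_a). Qed.

Lemma redP (x : 'Z_a) (k : nat) : (x : nat) = k %[mod a] -> red x = k%:R.
Proof.
move=> xk; apply: val_inj; rewrite /red /= !val_Zp_nat //.
by rewrite -(modn_dvdm x m_dvd_a) xk modn_dvdm.
Qed.

Lemma red_nat k : red k%:R = k%:R.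
Proof. by apply: redP => //; rewrite val_Zp_nat // modn_mod. Qed.

Lemma red0 : red 0 = 0. Proof. exact: (red_nat 0). Qed.
Lemma red1 : red 1 = 1. Proof. exact: (red_nat 1). Qed.

Lemma redD x y : red (x + y) = red x + red y.
Proof. by rewrite -[x in LHS]natr_Zp -[y in LHS]natr_Zp -natrD red_nat natrD. Qed.

Lemma redM x y : red (x * y) = red x * red y.
Proof. by rewrite -[x in LHS]natr_Zp -[y in LHS]natr_Zp -natrM red_nat natrM. Qed.

Lemma redN x : red (- x) = - red x.
Proof. by apply/eqP; rewrite -addr_eq0 -redD addNr red0. Qed.

Lemma red_sum (I : Type) (r : seq I) (Q : pred I) (g : I -> 'Z_a) :
  red (\sum_(i <- r | Q i) g i) = \sum_(i <- r | Q i) red (g i).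
Proof. exact: (big_morph red redD red0). Qed.

End Reduction.

(** * Fourier expansion of the event that a map kills the matrix *)

(** A matrix X with X - X^T = C is determined by its upper triangle, so sums over all its
    entries have to be folded onto this triangle. *)
Lemma sum_pairs_upper (V : nmodType) (n : nat) (u : 'I_n -> 'I_n -> V) :
  \sum_i \sum_j u i j =
  \sum_(k : 'I_n * 'I_n | (k.1 <= k.2)%N)
     (if k.1 == k.2 then u k.1 k.1 else u k.1 k.2 + u k.2 k.1).
Proof.
rewrite pair_bigA /= (bigID (fun k : 'I_n * 'I_n => (k.1 <= k.2)%N)) /=.
have -> : \sum_(k : 'I_n * 'I_n | ~~ (k.1 <= k.2)%N) u k.1 k.2 =
    \sum_(k : 'I_n * 'I_n | (k.1 <= k.2)%N) (if k.1 == k.2 then 0 else u k.2 k.1).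
  rewrite [RHS]big_mkcond [LHS]big_mkcond /=.
  have swap_inj : injective (fun k : 'I_n * 'I_n => (k.2, k.1)).
    by move=> [i j] [i' j'] [-> ->].
  rewrite (reindex_inj swap_inj) /=.
  apply: eq_bigr => -[i j] _ /=; rewrite -ltnNge ltn_neqAle.
  by rewrite -(inj_eq val_inj) /=; case: eqVneq; case: leqP.
rewrite -big_split; apply: eq_bigr => k _.
by case: k => i j /=; case: eqVneq => [->|_]; rewrite ?addr0.
Qed.

Section Fourier.
Local Open Scope complex_scope.
Variables (K : rcfType) (a m n : nat).
Hypotheses (a_gt0 : (0 < a)%N) (m_gt1 : (1 < m)%N) (m_dvd_a : (m %| a)%N).
Variable z : K[i].
Hypothesis z_prim : m.-primitive_root z.
Variable C : 'M['Z_a]_n.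
Local Notation G := ('Z_m * 'Z_m)%type.
Local Notation I2 := ('I_n * 'I_n)%type.
Implicit Types (c f : {ffun 'I_n -> G}) (g : {ffun I2 -> 'Z_a}) (k : I2).

Let redD := redD a_gt0 m_gt1 m_dvd_a.

(** The inverse of taking the upper triangle: below the diagonal, the entry is forced
    by X - X^T = C. *)
Definition symfill g : 'M['Z_a]_n :=
  \matrix_(i, j) if (i <= j)%N then g (i, j) else g (j, i) + C i j.

(** A map f from (Z/a)^n to (Z/m)^2 is encoded by the images [f i] of the basis
    vectors, and [lin f] is the map itself. *)
Definition lin f (v : 'cV['Z_a]_n) : G :=
  (\sum_i (f i).1 * red m (v i 0), \sum_i (f i).2 * red m (v i 0)).

Definition kills f (X : 'M['Z_a]_n) := [forall j, lin f (col j X) == 0].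

(** With f1 and f2 the two rows of f, this is f1 C f2^T: the obstruction to f X = 0,
    since f X f^T = 0 forces f1 (X - X^T) f2^T = 0. *)
Definition cross f : 'Z_m := \sum_i \sum_j (f i).1 * red m (C i j) * (f j).2.

(** The coefficient of the free entry X k in the exponent of the character of f X
    indexed by c; [shift] below is the part of this exponent that comes from C. *)
Definition coef c f k : 'Z_m :=
  if (k.1 <= k.2)%N then
    if k.1 == k.2 then dot (c k.1) (f k.1)
    else dot (c k.2) (f k.1) + dot (c k.1) (f k.2)
  else 0.

Definition shift c f : 'Z_m :=
  \sum_(k : I2 | (k.1 <= k.2)%N)
    (if k.1 == k.2 then 0 else dot (c k.1) (f k.2) * red m (C k.2 k.1)).

Lemma pairing_symfill c f g :
  \sum_j dot (c j) (lin f (col j (symfill g))) =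
  \sum_k coef c f k * red m (g k) + shift c f.
Proof.
have -> : \sum_j dot (c j) (lin f (col j (symfill g))) =
    \sum_i \sum_j dot (c j) (f i) * red m (symfill g i j).
  rewrite [RHS]exchange_big /=; apply: eq_bigr => j _.
  rewrite /dot /= !mulr_sumr -big_split; apply: eq_bigr => i _ /=.
  by rewrite mxE mulrDl !mulrA.
rewrite sum_pairs_upper (bigID (fun k : I2 => (k.1 <= k.2)%N) xpredT) /=.
rewrite [X in _ = _ + X + _]big1 ?addr0; last first.
  by move=> k /negPf h; rewrite /coef h mul0r.
rewrite /shift -big_split; apply: eq_bigr => -[i j] /= le_ij.
rewrite /coef /= le_ij !mxE; have [<-|ne] := eqVneq i j.
  by rewrite leqnn addr0.
rewrite le_ij; have -> : (j <= i)%N = false.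
  by apply/negbTE; rewrite -ltnNge ltn_neqAle le_ij andbT (inj_eq val_inj).
by rewrite redD; ring.
Qed.

Variable nu : I2 -> 'Z_a -> K.

(** Fourier inversion on ((Z/m)^2)^n.  Since the upper entries are independent and the
    exponent is affine in them, the expectation of each character factors. *)
Lemma fourier_kills f :
  ((m ^ 2) ^ n)%:R * (\sum_(g | kills f (symfill g)) \prod_k nu k (g k))%:C =
  \sum_(c : {ffun 'I_n -> G}) zchar z (shift c f) *
    \prod_k \sum_x (nu k x)%:C * zchar z (coef c f k * red m x).
Proof.
have kills_sum g : ((m ^ 2) ^ n * kills f (symfill g))%:R =
    \sum_(c : {ffun 'I_n -> G}) zchar z (\sum_j dot (c j) (lin f (col j (symfill g)))).
  under [RHS]eq_bigr do rewrite zchar_sum //.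
  rewrite -(bigA_distr_bigA (fun j u => zchar z (dot u (lin f (col j (symfill g)))))).
  under eq_bigr do rewrite sum_zchar_dot //.
  rewrite -natr_prod big_split prod_nat_const card_ord /=; congr (_ * _)%:R.
  have [/forallP h|] := boolP (kills f (symfill g)).
    by rewrite big1 // => j _; rewrite h.
  by rewrite negb_forall => /existsP[j /negPf h]; rewrite (bigD1 j) //= h.
have -> : ((m ^ 2) ^ n)%:R * (\sum_(g | kills f (symfill g)) \prod_k nu k (g k))%:C =
    \sum_(g : {ffun I2 -> 'Z_a})
      (\prod_k nu k (g k))%:C * ((m ^ 2) ^ n * kills f (symfill g))%:R.
  rewrite rmorph_sum mulr_sumr big_mkcond; apply: eq_bigr => g _ /=.
  by case: ifP => _; rewrite ?muln1 ?muln0 ?mulr0 // mulrC.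
under eq_bigr do rewrite kills_sum mulr_sumr.
rewrite exchange_big /=; apply: eq_bigr => c _.
rewrite bigA_distr_bigA mulr_sumr; apply: eq_bigr => g _ /=.
by rewrite pairing_symfill zcharD // zchar_sum // rmorph_prod big_split /= mulrA mulrC.
Qed.
End Fourier.

(** * Characters with few nonzero coefficients *)

Lemma pigeonhole (T V : finType) (A : {set T}) (c : T -> V) (s : nat) :
  (0 < #|V|)%N -> (#|V| * s <= #|A|)%N ->
  exists v, (s <= #|[set i in A | c i == v]|)%N.
Proof.
move=> V0; case: s => [|s] le_sA; first by case/card_gt0P: V0 => v _; exists v.
apply/existsP; apply: contraLR le_sA; rewrite negb_exists => /forallP h.
rewrite -ltnNge; apply: leq_ltn_trans (_ : #|V| * s < _)%N; last first.
  by rewrite ltn_mul2l V0 ltnSn.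
rewrite -sum1_card (partition_big c xpredT) //= -sum_nat_const.
apply: leq_sum => v _; rewrite -ltnS ltnNge; move: (h v); rewrite -sum1_card.
by under eq_bigl do rewrite inE.
Qed.

Section Weights.
Variables (m n : nat) (m_gt1 : (1 < m)%N).
Local Notation G := ('Z_m * 'Z_m)%type.
Local Notation I2 := ('I_n * 'I_n)%type.
Local Notation e1 := ((1%R, 0%R) : G).
Local Notation e2 := ((0%R, 1%R) : G).
Implicit Types (c f : {ffun 'I_n -> G}) (k : I2) (u : G * G).

(** Almost every f is rich for t proportional to n, and the positions where f takes
    the values (1, 0) and (0, 1) are enough to control the characters. *)
Definition rich t f :=
  (t <= #|[set i | f i == e1]|)%N && (t <= #|[set i | f i == e2]|)%N.

Definition ncoef c f := #|[set k | coef c f k != 0%R]|.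

(** The characters that are insensitive to the free entries: c is a multiple of the
    image of f under a quarter turn, so that the form c_j . f_i is alternating. *)
Definition special f (lam : 'Z_m) : {ffun 'I_n -> G} :=
  [ffun i => (lam * (f i).2, - (lam * (f i).1))].

(** The only value of c_j for which the coefficients of the entries (i, j) vanish both
    when (f i, c i) = ((1, 0), u.1) and when (f i, c i) = ((0, 1), u.2), where x = f j. *)
Definition adj u (x : G) : G := (- dot u.1 x, - dot u.2 x).

Definition defect u c f := #|[set j | c j != adj u (f j)]|.

Let symc c f i j : 'Z_m := dot (c j) (f i) + dot (c i) (f j).

Let dot10 (x : G) : dot x e1 = x.1.
Proof. by rewrite /dot /= mulr1 mulr0 addr0. Qed.
Let dot01 (x : G) : dot x e2 = x.2.
Proof. by rewrite /dot /= mulr1 mulr0 add0r. Qed.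

Lemma sum_symc_le c f :
  (\sum_i \sum_j ((i != j) && (symc c f i j != 0%R)) <= 2 * ncoef c f)%N.
Proof.
rewrite [leqLHS]sum_pairs_upper /ncoef -sum1_card big_distrr /= [leqRHS]big_mkcond.
rewrite [leqLHS]big_mkcond; apply: leq_sum => -[i j] _ /=.
rewrite inE /coef /=; case: (leqP i j) => //= le_ij.
have [_|ne] := eqVneq i j; first by rewrite eqxx.
rewrite /= [symc c f j i]addrC.
by rewrite -/(symc c f i j); case: (symc c f i j != 0%R).
Qed.

(** Each j at which c departs from [adj u] has a nonzero coefficient against all the
    positions i <> j of one of the two given families, since one of the two
    coordinates of c_j and [adj u (f j)] differs. *)
Lemma defect_le s u c f :
  (s <= #|[set i | (f i == e1) && (c i == u.1)]|)%N ->
  (s <= #|[set i | (f i == e2) && (c i == u.2)]|)%N ->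
  (defect u c f * s.-1 <= 2 * ncoef c f)%N.
Proof.
move=> s1 s2; apply: leq_trans (sum_symc_le c f).
rewrite exchange_big /= /defect -sum_nat_const big_mkcond; apply: leq_sum => j _.
rewrite inE; case: ifP => // cj.
have card_le (A : {set 'I_n}) : (s <= #|A|)%N ->
    (forall i, i \in A -> symc c f i j != 0%R) ->
    (s.-1 <= \sum_i ((i != j) && (symc c f i j != 0%R)))%N.
  move=> sA hA; apply: (@leq_trans #|A :\ j|).
    by rewrite -subn1 leq_subLR (leq_trans sA) // (cardsD1 j A) leq_add2r leq_b1.
  rewrite -sum1_card big_mkcond; apply: leq_sum => i _.
  by rewrite !inE; case: eqVneq => //= ij; case: ifP => // /hA ->.
have [eq1|ne1] := eqVneq (c j).1 (- dot u.1 (f j)); last first.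
  apply: card_le s1 _ => i; rewrite inE => /andP[/eqP fi /eqP ci].
  by rewrite /symc fi ci dot10 addr_eq0.
apply: card_le s2 _ => i; rewrite inE => /andP[/eqP fi /eqP ci].
rewrite /symc fi ci dot01 addr_eq0; apply: contraNneq cj => eq2.
by rewrite /adj -eq1 -eq2; case: (c j).
Qed.

(** Without defect, c_i = A (f i) for a 2 x 2 matrix A.  If A is not alternating, it is
    detected on the diagonal entries at the positions of one basis vector, or on the
    entries that pair one position of (1, 0) with all those of (0, 1). *)
Lemma defect0_special t u c f : rich t f -> defect u c f = 0%N ->
  (exists lam, c = special f lam) \/ (t <= 2 * ncoef c f)%N.
Proof.
move=> /andP[t1 t2] /eqP; rewrite cards_eq0 => /eqP W0.
have cE i : c i = adj u (f i).
  by apply/eqP; move/setP/(_ i): W0; rewrite !inE => /negbFE.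
have diag (A : {set 'I_n}) : (t <= #|A|)%N ->
    (forall i, i \in A -> dot (c i) (f i) != 0) -> (t <= 2 * ncoef c f)%N.
  move=> tA hA; apply: leq_trans tA _; apply: (@leq_trans (ncoef c f)); last first.
    by rewrite mul2n -addnn leq_addr.
  have dinj : injective (fun i : 'I_n => (i, i)) by move=> i j [].
  rewrite -(card_imset _ dinj); apply: subset_leq_card.
  apply/fintype.subsetP => _ /imsetP[i iA ->].
  by rewrite inE /coef /= leqnn eqxx hA.
have [u11|u11] := eqVneq u.1.1 0; last first.
  right; apply: diag t1 _ => i; rewrite inE => /eqP fi.
  by rewrite cE fi dot10 /= dot10 oppr_eq0.
have [u22|u22] := eqVneq u.2.2 0; last first.
  right; apply: diag t2 _ => i; rewrite inE => /eqP fi.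
  by rewrite cE fi dot01 /= dot01 oppr_eq0.
have [u12|u12] := eqVneq (u.1.2 + u.2.1) 0.
  left; exists (- u.1.2); apply/ffunP => i; rewrite cE ffunE /adj /dot u11 u22.
  have -> : u.2.1 = - u.1.2 by apply/eqP; rewrite -addr_eq0 addrC u12.
  by rewrite !mul0r add0r addr0 !mulNr !opprK.
right; case: t t1 t2 {diag} => // t t1 t2.
have /card_gt0P[i0] : (0 < #|[set i | f i == e1]|)%N by exact: leq_trans t1.
rewrite inE => /eqP fi0; apply: leq_trans t2 (leq_trans _ (sum_symc_le c f)).
rewrite (bigD1 i0) //=; apply: leq_trans (leq_addr _ _).
rewrite -sum1_card big_mkcond; apply: leq_sum => j _; rewrite inE.
have [fj|//] := eqVneq (f j) e2.
rewrite /symc !cE fi0 fj dot10 dot01 /= dot10 dot01 -opprD oppr_eq0 u12 andbT.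
suff -> : i0 != j by [].
by apply: contra_eq_neq fj => <-; rewrite fi0 xpair_eqE oner_eq0.
Qed.

(** The two families are the positions of (1, 0) and of (0, 1) at which c takes its most
    frequent value; c takes only m ^ 2 values. *)
Lemma exists_defect s t c f : rich t f -> (m ^ 2 * s <= t)%N ->
  exists u, (defect u c f * s.-1 <= 2 * ncoef c f)%N.
Proof.
move=> /andP[t1 t2] st.
have cardG : #|{: G}| = (m ^ 2)%N by rewrite card_prod !card_ord Zp_cast.
have G0 : (0 < #|{: G}|)%N by rewrite cardG expn_gt0 ltnW.
have st1 := leq_trans st t1; have st2 := leq_trans st t2.
rewrite -cardG in st1 st2.
have [u1 h1] := pigeonhole c G0 st1; have [u2 h2] := pigeonhole c G0 st2.
exists (u1, u2); apply: defect_le; [move: h1|move: h2];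
  by congr (_ <= _)%N; apply: eq_card => i; rewrite !inE.
Qed.

Lemma coef_special f lam k : coef (special f lam) f k = 0.
Proof.
rewrite /coef !ffunE /dot /=; case: ifP => // _.
by case: (k.1 == k.2); ring.
Qed.

(** On a special character the whole exponent is lam f1 X f2^T - lam f2 X f1^T, that is
    lam f1 (X - X^T) f2^T, which depends on C alone. *)
Lemma shift_special (a : nat) (C : 'M['Z_a]_n) f lam :
  (0 < a)%N -> (m %| a)%N -> C^T = - C -> (forall i, C i i = 0) ->
  shift C (special f lam) f = lam * cross C f.
Proof.
move=> a0 ma CT C0; rewrite /cross sum_pairs_upper mulr_sumr /shift.
apply: eq_bigr => -[i j] _ /=; have [_|_] := eqVneq i j.
  by rewrite C0 red0 // !(mulr0, mul0r).
have -> : C i j = - C j i by move/matrixP/(_ j i): CT; rewrite !mxE.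
by rewrite redN // /dot !ffunE /=; ring.
Qed.

Lemma special_inj t f : (0 < t)%N -> rich t f -> injective (special f).
Proof.
move=> t0 /andP[t1 _] lam mu.
case/card_gt0P: (leq_trans t0 t1) => i.
rewrite inE => /eqP fi /ffunP/(_ i); rewrite !ffunE fi => /(congr1 snd).
by rewrite /snd !mulr1 => /oppr_inj.
Qed.

End Weights.

(** * The probability that a map kills the matrix *)

Section Estimate.
Local Open Scope complex_scope.
Variables (K : rcfType) (a m n : nat).
Hypotheses (a_gt0 : (0 < a)%N) (m_gt1 : (1 < m)%N) (m_dvd_a : (m %| a)%N).
Variable z : K[i].
Hypothesis z_prim : m.-primitive_root z.
Variable C : 'M['Z_a]_n.
Hypotheses (CT : C^T = - C) (C0 : forall i, C i i = 0).
Local Notation G := ('Z_m * 'Z_m)%type.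
Local Notation I2 := ('I_n * 'I_n)%type.
Implicit Types (c f : {ffun 'I_n -> G}) (g : {ffun I2 -> 'Z_a}) (u : G * G).

Variables (nu : I2 -> 'Z_a -> K) (sigma : K).
Hypothesis sigma01 : 0 <= sigma <= 1.
Hypothesis nu_sum1 : forall k, \sum_x nu k x = 1.
Hypothesis nu_char : forall (k : I2) (b : 'Z_m), (k.1 <= k.2)%N -> b != 0 ->
  `|\sum_x (nu k x)%:C * zchar z (b * red m x)| <= (sigma ^+ 2)%:C.

Definition fourier_term c f : K[i] :=
  zchar z (shift C c f) *
    \prod_k \sum_x (nu k x)%:C * zchar z (coef c f k * red m x).

Lemma fourier_term_special f lam : cross C f = 0 ->
  fourier_term (special f lam) f = 1.
Proof.
move=> Cf; rewrite /fourier_term shift_special // Cf mulr0 zchar0 mul1r.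
rewrite big1 // => k _; rewrite coef_special.
by under eq_bigr do rewrite mul0r zchar0 mulr1; rewrite -rmorph_sum nu_sum1 rmorph1.
Qed.

Lemma norm_fourier_term c f : `|fourier_term c f| <= (sigma ^+ (2 * ncoef c f))%:C.
Proof.
rewrite normrM norm_zchar // mul1r normr_prod.
have -> : (sigma ^+ (2 * ncoef c f))%:C =
    \prod_k (if coef c f k != 0 then sigma ^+ 2 else 1)%:C.
  rewrite -rmorph_prod -big_mkcond /= prodr_const exprM; congr ((_ ^+ _)%:C).
  by apply: eq_card => k; rewrite !inE.
apply: ler_prod => k _; rewrite normr_ge0 /=.
have [->|b0] := eqVneq (coef c f k) 0.
  under eq_bigr do rewrite mul0r zchar0 mulr1.
  by rewrite -rmorph_sum nu_sum1 /= rmorph1 normr1.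
by apply: nu_char => //; move: b0; rewrite /coef; case: ifP => //; rewrite eqxx.
Qed.

(** There are m ^ 4 choices of u.  For each of them, the characters whose defect is w
    number at most 'C(n, w) m ^ 2w and contribute at most sigma ^ (w * s.-1) each,
    which sums to an n-th power.  Its term w = 0 is the constant 1; but the single
    character without defect, when it is not special, contributes at most sigma ^ t. *)
Definition fourier_error (s t : nat) : K :=
  (m ^ 4)%:R * ((1 + (m ^ 2)%:R * sigma ^+ s.-1) ^+ n - 1 + sigma ^+ t).

Lemma card_G : #|{: G}| = (m ^ 2)%N.
Proof. by rewrite card_prod !card_ord Zp_cast. Qed.

(** Summing this over all u avoids choosing u as a function of c. *)
Let nonspecial_bound (s t : nat) u c f : K :=
  sigma ^+ (defect u c f * s.-1) +
  (if c == [ffun j => adj u (f j)] then sigma ^+ t - 1 else 0).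

Lemma nonspecial_bound_ge0 s t u c f : 0 <= nonspecial_bound s t u c f.
Proof.
case/andP: sigma01 => s0 s1; rewrite /nonspecial_bound; case: eqP => [->|_].
  rewrite /defect; set A := [set _ | _]; have -> : A = finset.set0.
    by apply/setP => j; rewrite !inE ffunE eqxx.
  by rewrite cards0 mul0n expr0 addrCA subrr addr0 exprn_ge0.
by rewrite addr0 exprn_ge0.
Qed.

(** The defect is a sum over positions, so the sum over all c factors into n equal
    sums over the values of one c_j. *)
Lemma sum_nonspecial_bound s t u f :
  \sum_c nonspecial_bound s t u c f <=
  (1 + (m ^ 2)%:R * sigma ^+ s.-1) ^+ n - 1 + sigma ^+ t.
Proof.
case/andP: sigma01 => s0 s1.
rewrite big_split /= -big_mkcond big_pred1_eq -addrA [- 1 + _]addrC lerD2r.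
have -> : \sum_c sigma ^+ (defect u c f * s.-1) =
    \sum_(c : {ffun 'I_n -> G}) \prod_j (if c j != adj u (f j) then sigma ^+ s.-1 else 1).
  apply: eq_bigr => c _; rewrite -big_mkcond prodr_const mulnC exprM.
  by congr (_ ^+ _); apply: eq_card => j; rewrite !inE.
rewrite -(bigA_distr_bigA (fun j v => if v != adj u (f j) then sigma ^+ s.-1 else 1)).
rewrite -[X in _ <= _ ^+ X](card_ord n) -prodr_const; apply: ler_prod => j _.
rewrite sumr_ge0 => [/=|v _]; last by case: ifP => _ //; rewrite exprn_ge0.
rewrite (bigD1 (adj u (f j))) //= eqxx /= lerD2l -card_G mulr_natl -sumr_const.
rewrite [leLHS]big_mkcond [leRHS]big_mkcond; apply: ler_sum => v _ /=.
by case: (v != _); rewrite ?exprn_ge0.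
Qed.

Lemma sum_nonspecial s t f : rich t f -> (m ^ 2 * s <= t)%N ->
  \sum_(c | c \notin codom (special f)) `|fourier_term c f| <= (fourier_error s t)%:C.
Proof.
move=> ft st; case/andP: sigma01 => s0 s1.
apply: (@le_trans _ _ (\sum_c \sum_u nonspecial_bound s t u c f)%:C); last first.
  rewrite lecR exchange_big /=.
  apply: le_trans (ler_sum _ (fun u _ => sum_nonspecial_bound s t u f)) _.
  by rewrite sumr_const card_prod !card_G -expnD /fourier_error -[leLHS]mulr_natl.
rewrite rmorph_sum big_mkcond; apply: ler_sum => c _ /=.
have T0 : 0 <= \sum_u nonspecial_bound s t u c f.
  by apply: sumr_ge0 => u _; exact: nonspecial_bound_ge0.
case: ifPn => [csp|_]; last by rewrite ler0c.
have [u hu] := exists_defect m_gt1 c ft st.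
apply: le_trans (norm_fourier_term c f) _; rewrite lecR (bigD1 u) //=.
apply: (@le_trans _ _ (nonspecial_bound s t u c f)); last first.
  by rewrite lerDl sumr_ge0 // => v _; exact: nonspecial_bound_ge0.
rewrite /nonspecial_bound; case: eqP => [cE|_]; last first.
  by rewrite addr0 ler_wiXn2l.
have d0 : defect u c f = 0%N.
  by apply/eqP; rewrite cards_eq0; apply/eqP/setP => j; rewrite !inE cE ffunE eqxx.
rewrite d0 mul0n expr0 addrCA subrr addr0 ler_wiXn2l //.
case: (defect0_special ft d0) => // -[lam clam].
by case/negP: csp; rewrite clam codom_f.
Qed.

(** The m special characters contribute 1 each when [cross C f] vanishes; the others are
    an error term. *)
Lemma kills_lower s t f : (0 < t)%N -> rich t f -> (m ^ 2 * s <= t)%N -> cross C f = 0 ->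
  m%:R - fourier_error s t <=
  ((m ^ 2) ^ n)%:R * \sum_(g | kills f (symfill C g)) \prod_k nu k (g k).
Proof.
move=> t0 ft st Cf; set P := \sum_(g | _) _.
have := fourier_kills a_gt0 m_gt1 m_dvd_a z_prim C nu f; rewrite -/P.
rewrite (bigID (mem (codom (special f)))) /=.
have -> : \sum_(c in codom (special f)) fourier_term c f = m%:R.
  rewrite (eq_bigr (fun=> 1)) => [|c /codomP[lam ->]]; last exact: fourier_term_special.
  rewrite sumr_const card_codom; last exact: special_inj t0 ft.
  by rewrite card_ord Zp_cast.
set S := \sum_(c | _) _ => PE.
have hS : `|S| <= (fourier_error s t)%:C.
  exact: le_trans (ler_norm_sum _ _ _) (sum_nonspecial ft st).
have SE : S = (((m ^ 2) ^ n)%:R * P - m%:R)%:C.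
  by rewrite rmorphB rmorphM !rmorph_nat PE addrAC subrr add0r.
move: hS; rewrite SE normc_def /= expr0n addr0 sqrtr_sqr lecR ler_norml => /andP[h _].
by lra.
Qed.

End Estimate.

(** * Counting maps *)

(** All nonempty fibers are translates of the kernel. *)
Lemma card_le_fiber (A B : finZmodType) (phi : A -> B) (D : {set B}) :
  (forall x y, phi (x - y) = phi x - phi y) -> (forall x, phi x \in D) ->
  (#|A| <= #|D| * #|[set x | phi x == 0%R]|)%N.
Proof.
move=> phiB phiD; rewrite -[leqLHS]sum1_card (partition_big phi (fun b => b \in D)) //=.
rewrite -sum_nat_const; apply: leq_sum => b _; rewrite sum1_card.
have [->|[x /eqP xb]] : #|[pred x | phi x == b]| = 0%N \/ exists x, phi x == b.
- have [/existsP|] := boolP [exists x, phi x == b]; first by right.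
  by rewrite negb_exists => /forallP h; left; apply: eq_card0 => x; rewrite inE; apply/negbTE.
- exact: leq0n.
rewrite -(card_imset _ (addIr (- x))); apply: subset_leq_card.
by apply/fintype.subsetP => _ /imsetP[y /eqP yb ->]; rewrite inE phiB xb yb subrr.
Qed.

Lemma natr_valB (R : pzRingType) (m : nat) (x y : 'Z_m) :
  (1 < m)%N -> m%:R = 0 :> R -> (nat_of_ord (x - y)%R)%:R = x%:R - y%:R :> R.
Proof.
move=> m1 m0; have modE k : (k %% m)%:R = k%:R :> R.
  by rewrite [in RHS](divn_eq k m) natrD natrM m0 mulr0 add0r.
have xE : x = x - y + y by rewrite subrK.
move: xE; set d := x - y => ->; apply/eqP; rewrite eq_sym subr_eq -natrD.
by rewrite -[X in _ == X]modE; apply/eqP; congr _%:R; congr (_ %% _)%N; exact: Zp_cast.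
Qed.

Section RichCount.
Variables (K : realFieldType) (m n : nat) (m_gt1 : (1 < m)%N).
Local Notation G := ('Z_m * 'Z_m)%type.

Let rare t (v : G) := [set f : {ffun 'I_n -> G} | (#|[set i | f i == v]| < t)%N].

(** Markov's inequality for 2 ^ - N, where N is the number of positions of v: its mean
    over all f is (1 - m ^ -2 / 2) ^ n. *)
Lemma card_rare t v : #|rare t v|%:R <= 2 ^+ t * ((m ^ 2)%:R - 2^-1) ^+ n :> K.
Proof.
have cardG : #|{: G}| = (m ^ 2)%N by rewrite card_prod !card_ord Zp_cast.
pose w (u : G) : K := if u == v then 2^-1 else 1.
have -> : ((m ^ 2)%:R - 2^-1) ^+ n = \sum_(f : {ffun 'I_n -> G}) \prod_i w (f i).
  rewrite -(bigA_distr_bigA (fun _ u => w u)) prodr_const card_ord; congr (_ ^+ _).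
  rewrite (bigD1 v) //= {1}/w eqxx.
  under eq_bigr => u /negPf ne do rewrite /w ne.
  rewrite sumr_const (eq_card (_ : _ =i predC1 v)) //.
  have : (1 + #|predC1 v| = m ^ 2)%N.
    by rewrite cardC1 cardG add1n prednK // expn_gt0 ltnW.
  by move=> <-; rewrite natrD; lra.
rewrite mulr_sumr -sum1_card natr_sum big_mkcond; apply: ler_sum => f _ /=.
have -> : \prod_i w (f i) = 2^-1 ^+ #|[set i | f i == v]|.
  rewrite /w -big_mkcond prodr_const; congr (_ ^+ _).
  by apply: eq_card => i; rewrite !inE.
rewrite inE; case: ltnP => [lt_t|_]; last by rewrite mulr_ge0 ?exprn_ge0 ?invr_ge0.
by rewrite exprVn ler_pdivlMr ?exprn_gt0 // mul1r ler_eXn2l ?ltr1n // ltnW.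
Qed.

Lemma card_not_rich t :
  #|[set f : {ffun 'I_n -> G} | ~~ rich t f]|%:R <=
  2 * (2 ^+ t * ((m ^ 2)%:R - 2^-1) ^+ n) :> K.
Proof.
have sub : [set f : {ffun 'I_n -> G} | ~~ rich t f] \subset rare t (1, 0) :|: rare t (0, 1).
  by apply/fintype.subsetP => f; rewrite !inE negb_and -!ltnNge.
rewrite mulr_natl mulr2n; apply: le_trans (lerD (card_rare t (1, 0)) (card_rare t (0, 1))).
by rewrite -natrD ler_nat (leq_trans (subset_leq_card sub)) // cardsU leq_subr.
Qed.

End RichCount.

Section CrossCount.
Variables (K : realFieldType) (a h p n B : nat).
Hypotheses (a_gt0 : (0 < a)%N) (h_gt0 : (0 < h)%N) (h_dvd_a : (h %| a)%N).
Hypotheses (p_prime : prime p) (p_dvd : (p %| a %/ h)%N).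
Variable C : 'M['Z_a]_n.
Hypothesis C_div : forall i j, exists b, C i j = h%:R * b.
Hypothesis rankB : (\rank (reduce_mx p (divmx h C)) <= B)%N.
Local Notation m := (h * p)%N.
Local Notation G := ('Z_m * 'Z_m)%type.

Lemma hp_gt1 : (1 < m)%N.
Proof. by apply: leq_trans (prime_gt1 p_prime) _; rewrite leq_pmull. Qed.

Lemma hp_dvd : (m %| a)%N.
Proof. by rewrite -(divnK h_dvd_a) mulnC dvdn_mul. Qed.

Let a_gt1 : (1 < a)%N.
Proof. exact: leq_trans hp_gt1 (dvdn_leq a_gt0 hp_dvd). Qed.

Lemma dvdn_C i j : (h %| (C i j : nat))%N.
Proof.
have [b ->] := C_div i j; rewrite -[b]natr_Zp -natrM val_Zp_nat //.
by rewrite /dvdn modn_dvdm // modnMr.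
Qed.

Lemma C_divK i j : (h * (C i j %/ h))%N = C i j.
Proof. by rewrite mulnC divnK ?dvdn_C. Qed.

Lemma reduce_divE i j : reduce_mx p (divmx h C) i j = ((C i j : nat) %/ h)%:R.
Proof.
have ah1 : (1 < a %/ h)%N.
  by apply: leq_trans (prime_gt1 p_prime) (dvdn_leq _ p_dvd); rewrite divn_gt0 // dvdn_leq.
rewrite !mxE /divZp val_Zp_nat //; apply/val_inj => /=.
by rewrite !val_Fp_nat // modn_dvdm.
Qed.

(** The bilinear form [cross] in terms of the two rows x and y of f. *)
Let Q (x y : 'rV['Z_m]_n) := (x *m map_mx (red m) C *m y^T) 0 0.

Let reduceF (x : 'rV['Z_m]_n) : 'rV['F_p]_n :=
  map_mx (fun y : 'Z_m => (y : nat)%:R) x *m reduce_mx p (divmx h C).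

Lemma reduceF_eq0 x : reduceF x = 0 -> x *m map_mx (red m) C = 0.
Proof.
move/rowP=> x0; apply/rowP => j; move: (x0 j); rewrite !mxE.
under eq_bigr do rewrite mxE reduce_divE -natrM.
rewrite -natr_sum; set N := (\sum_i _)%N => N0.
have pN : (p %| N)%N by rewrite (dvdn_pcharf (pchar_Fp p_prime)) N0.
transitivity ((h * N)%:R : 'Z_m).
  rewrite /N big_distrr natr_sum; apply: eq_bigr => i _; rewrite mxE /red /=.
  by rewrite mulnCA C_divK natrM natr_Zp.
apply: val_inj; rewrite /= val_Zp_nat ?hp_gt1 //.
by apply/eqP; rewrite -/(dvdn _ _) dvdn_pmul2l.
Qed.

(** As C is a multiple of h, the form takes its values in h (Z / hp), which has only p
    elements. *)
Lemma Q_h x y : exists k : 'I_p, Q x y = (h * k)%:R.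
Proof.
have [k ->] : exists k : nat, Q x y = (h * k)%:R.
  exists (\sum_j (\sum_i (x 0%R i : nat) * (C i j %/ h)) * y 0%R j)%N.
  rewrite /Q mxE big_distrr natr_sum; apply: eq_bigr => j _.
  rewrite !mxE /= mulnA natrM natr_Zp; congr (_ * _).
  rewrite big_distrr natr_sum; apply: eq_bigr => i _; rewrite mxE /red /=.
  by rewrite mulnCA C_divK natrM natr_Zp.
exists (Ordinal (ltn_pmod k (prime_gt0 p_prime))) => /=.
apply: val_inj; rewrite /= !val_Zp_nat ?hp_gt1 //.
by rewrite -!muln_modr modn_mod.
Qed.

Lemma card_rV : #|{: 'rV['Z_m]_n}| = (m ^ n)%N.
Proof. by rewrite card_mx mul1n card_ord Zp_cast // hp_gt1. Qed.

Let ker_r x := #|[set y | Q x y == 0]|.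

Lemma ker_r_ge x : (m ^ n <= p * ker_r x)%N.
Proof.
rewrite -card_rV; pose D := (fun k : 'I_p => (h * k)%:R : 'Z_m) @: finset.setT.
have QB y y' : Q x (y - y') = Q x y - Q x y'.
  by rewrite /Q linearB /= mulmxBr !mxE.
have QD y : Q x y \in D by have [k ->] := Q_h x y; apply/imsetP; exists k.
apply: leq_trans (card_le_fiber QB QD) _; rewrite leq_mul2r.
by rewrite (leq_trans (leq_imset_card _ _)) ?orbT // cardsT card_ord.
Qed.

Lemma ker_r_full x : reduceF x == 0 -> ker_r x = (m ^ n)%N.
Proof.
move/eqP/reduceF_eq0 => x0; rewrite -card_rV /ker_r; apply: eq_card => y.
by rewrite !inE /Q x0 mul0mx mxE eqxx.
Qed.

Lemma card_reduceF_ker : (m ^ n <= p ^ B * #|[set x | reduceF x == 0%R]|)%N.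
Proof.
rewrite -card_rV; pose M := reduce_mx p (divmx h C).
pose D := (fun w : 'rV['F_p]_(\rank M) => w *m row_base M) @: finset.setT.
have FB x y : reduceF (x - y) = reduceF x - reduceF y.
  rewrite /reduceF -mulmxBl; congr (_ *m _); apply/rowP => j; rewrite !mxE.
  rewrite natr_valB ?hp_gt1 // natrM.
  by have -> : p%:R = 0 :> 'F_p; [exact/pcharf0/pchar_Fp|rewrite mulr0].
have FD x : reduceF x \in D.
  have /submxP[w wE] : (reduceF x <= row_base M)%MS by rewrite eq_row_base submxMl.
  by apply/imsetP; exists w.
apply: leq_trans (card_le_fiber FB FD) _; rewrite leq_mul2r.
rewrite (leq_trans (leq_imset_card _ _)) ?orbT // cardsT card_mx mul1n card_Fp //.
by rewrite leq_exp2l ?prime_gt1.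
Qed.

(** The rows in the kernel of [reduceF] are orthogonal to every y, and any other row is
    orthogonal to a proportion at least 1 / p of the y. *)
Let sum_ker_r_ge :
  (m ^ n * (m ^ n + p.-1 * #|[set x | reduceF x == 0%R]|) <= p * \sum_x ker_r x)%N.
Proof.
have p0 := prime_gt0 p_prime.
apply: (@leq_trans (\sum_x (m ^ n + p.-1 * (m ^ n * (reduceF x == 0%R)))))%N.
  rewrite big_split sum_nat_const /= card_rV -!big_distrr /=.
  rewrite -sum1_card [X in (_ * (_ + _ * X) <= _)%N]big_mkcond mulnDr.
  rewrite leq_add2l mulnCA leq_mul2l leq_mul2l; apply/orP; right; apply/orP; right.
  by apply: leq_sum => x _; rewrite inE; case: (_ == _).
rewrite big_distrr; apply: leq_sum => x _ /=.
have [x0|_] := boolP (reduceF x == 0); last by rewrite !muln0 addn0 ker_r_ge.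
by rewrite ker_r_full // muln1 -mulSn prednK.
Qed.

Let card_cross_ge :
  (\sum_x ker_r x <= #|[set f : {ffun 'I_n -> G} | cross C f == 0%R]|)%N.
Proof.
pose F (xy : 'rV['Z_m]_n * 'rV['Z_m]_n) : {ffun 'I_n -> G} :=
  [ffun i => (xy.1 0 i, xy.2 0 i)].
have F_inj : injective F.
  move=> [x y] [x' y'] /ffunP e; congr pair; apply/rowP => i.
    by have := congr1 fst (e i); rewrite !ffunE.
  by have := congr1 snd (e i); rewrite !ffunE.
have -> : (\sum_x ker_r x = #|[set xy | Q xy.1 xy.2 == 0%R]|)%N.
  rewrite -sum1_card (eq_bigl (fun xy => xpredT xy.1 && (Q xy.1 xy.2 == 0))); last first.
    by move=> xy; rewrite inE.
  rewrite -(pair_big_dep xpredT (fun x y => Q x y == 0) (fun _ _ => 1%N)) /=.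
  by apply: eq_bigr => x _; rewrite /ker_r -sum1_card; apply: eq_bigl => y; rewrite inE.
rewrite -(card_imset _ F_inj); apply: subset_leq_card.
apply/fintype.subsetP => _ /imsetP[[x y] + ->]; rewrite !inE /= => /eqP Qxy; apply/eqP.
rewrite -[RHS]Qxy /Q mxE /cross exchange_big; apply: eq_bigr => j _.
by rewrite !mxE big_distrl; apply: eq_bigr => i _; rewrite !ffunE mxE.
Qed.

(** A row x lies in the kernel of C / h mod p with frequency at least p ^ - B, and there
    [cross] vanishes identically.  The surplus over the frequency 1 / p of a form that
    would be equidistributed is what makes the final inequality strict. *)
Lemma card_cross :
  ((m ^ 2) ^ n)%:R * (p%:R^-1 + p%:R ^- B * (1 - p%:R^-1)) <=
  #|[set f : {ffun 'I_n -> G} | cross C f == 0%R]|%:R :> K.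
Proof.
have p0 := prime_gt0 p_prime.
have pK : 0 < p%:R :> K by rewrite ltr0n.
apply: (@le_trans _ _ (\sum_x ker_r x)%:R); last by rewrite ler_nat card_cross_ge.
rewrite -(ler_pM2l pK) -natrM.
apply: le_trans (_ : _ <= (m ^ n * (m ^ n + p.-1 * #|[set x | reduceF x == 0%R]|))%:R) _;
  last by rewrite ler_nat sum_ker_r_ge.
set Z := #|_|; have ZM : (m ^ n)%:R * p%:R ^- B <= Z%:R :> K.
  by rewrite ler_pdivrMr ?exprn_gt0 // mulrC -natrX -natrM ler_nat card_reduceF_ker.
have pE : p%:R = p.-1%:R + 1 :> K by rewrite natr1 prednK.
have -> : p%:R * (((m ^ 2) ^ n)%:R * (p%:R^-1 + p%:R ^- B * (1 - p%:R^-1))) =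
    (m ^ n)%:R * ((m ^ n)%:R + p.-1%:R * ((m ^ n)%:R * p%:R ^- B)) :> K.
  rewrite -expnM mul2n -addnn expnD natrM.
  have -> : p.-1%:R = p%:R - 1 :> K by rewrite pE addrK.
  set q := p%:R ^- B; field; exact: lt0r_neq0.
by rewrite natrM natrD natrM ler_wpM2l // lerD2l ler_wpM2l.
Qed.
End CrossCount.

(** * Surjections from the cokernel *)

Section Surjections.
Local Open Scope quotient_scope.
Variables (a m n : nat).
Hypotheses (a_gt0 : (0 < a)%N) (m_gt1 : (1 < m)%N) (m_dvd_a : (m %| a)%N).
Local Notation G := ('Z_m * 'Z_m)%type.
Implicit Types (f : {ffun 'I_n -> G}) (X : 'M['Z_a]_n) (v : 'cV['Z_a]_n).

Lemma linD f v w : lin f (v + w) = lin f v + lin f w.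
Proof.
by congr pair => /=; rewrite -big_split; apply: eq_bigr => i _; rewrite mxE redD ?mulrDr.
Qed.

Lemma lin0 f : lin f (0 : 'cV['Z_a]_n) = 0.
Proof. by congr pair; rewrite big1 // => i _; rewrite mxE red0 ?mulr0. Qed.

Lemma linN f v : lin f (- v) = - lin f v.
Proof. by apply/eqP; rewrite -addr_eq0 -linD addNr lin0. Qed.

Lemma kills_mximage f X v : kills f X -> v \in mximage X -> lin f v = 0.
Proof.
move=> /forallP fX /existsP[u /eqP ->].
have comb0 (x : 'I_n -> 'Z_m) : (forall j, \sum_i x i * red m (X i j) = 0) ->
    \sum_i x i * red m ((X *m u) i 0) = 0.
  move=> x0; under eq_bigr do rewrite mxE red_sum // mulr_sumr.
  rewrite exchange_big big1 //= => j _.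
  by under eq_bigr do rewrite redM // mulrA; rewrite -mulr_suml x0 mul0r.
congr pair; apply: comb0 => j.
- have /eqP/(congr1 fst)/= fXj := fX j.
  by rewrite -[RHS]fXj; apply: eq_bigr => i _; rewrite mxE.
- have /eqP/(congr1 snd)/= fXj := fX j.
  by rewrite -[RHS]fXj; apply: eq_bigr => i _; rewrite mxE.
Qed.

Definition coker_map X f : {ffun coker X -> Zsquare m} :=
  [ffun x : coker X => lin f (repr x) : Zsquare m].

Lemma coker_map_pi X f v : kills f X -> coker_map X f (\pi_(coker X) v) = lin f v.
Proof.
move=> fX; rewrite ffunE; apply/eqP; rewrite -subr_eq0 -linN -linD; apply/eqP.
by apply: (kills_mximage fX); rewrite Quotient.idealrBE reprK.
Qed.

Lemma lin_delta f i (y : 'Z_a) :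
  lin f (y *: delta_mx i 0) = ((f i).1 * red m y, (f i).2 * red m y).
Proof.
by congr pair; rewrite (bigD1 i) //= big1 ?addr0 => [|j /negPf ji];
  rewrite !mxE ?eqxx ?ji ?mulr1 // mulr0 red0 // mulr0.
Qed.

(** Every surjection from the cokernel comes from a map killing X; restricting to rich
    maps loses some of them but gives surjectivity for free. *)
Lemma card_kills_le_Sur X t : (0 < t)%N ->
  (#|[set f : {ffun 'I_n -> G} | rich t f && kills f X]| <= #|Sur (coker X) (Zsquare m)|)%N.
Proof.
move=> t0.
have map_inj : {in [set f : {ffun 'I_n -> G} | rich t f && kills f X] &,
    injective (coker_map X)}.
  move=> f f'; rewrite !inE => /andP[_ fX] /andP[_ f'X] e; apply/ffunP => i.
  have := congr1 (fun F : {ffun coker X -> Zsquare m} =>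
    F (\pi_(coker X) (1 *: delta_mx i 0))) e.
  rewrite !coker_map_pi // !lin_delta //.
  by rewrite red1 // !mulr1; case: (f i); case: (f' i).
rewrite -(card_in_imset map_inj); apply: subset_leq_card.
apply/fintype.subsetP => _ /imsetP[f + ->].
rewrite !inE => /andP[/andP[f1 f2] fX]; apply/andP; split.
  apply/forallP => x; apply/forallP => y; apply/eqP.
  rewrite -[x]reprK -[y]reprK -[X in coker_map _ _ X](Quotient.pi_add _ (repr x) (repr y)).
  by rewrite !coker_map_pi // linD.
apply/forallP => -[y1 y2]; apply/existsP.
case/card_gt0P: (leq_trans t0 f1) => i; rewrite inE => /eqP fi.
case/card_gt0P: (leq_trans t0 f2) => j; rewrite inE => /eqP fj.
exists (\pi_(coker X) ((y1 : nat)%:R *: delta_mx i 0 + (y2 : nat)%:R *: delta_mx j 0)).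
rewrite coker_map_pi // linD !lin_delta // fi fj /= !mul0r !mul1r !red_nat // !natr_Zp.
by apply/eqP; congr pair; rewrite /= ?addr0 ?add0r.
Qed.

End Surjections.

(** * The exterior square of the torsion subgroup *)

Section Wedge.
Local Open Scope quotient_scope.
Variable A : finZmodType.
Local Notation E := (exterior_square A).

Definition wedge (x y : A) : E := \pi_E (freegen x y).

Let piB (f g : {ffun A * A -> int}) : \pi_E (f - g) = \pi_E f - \pi_E g.
Proof. by rewrite Quotient.pi_add Quotient.pi_opp. Qed.

Let wedge_rel f : wedge_relations f -> \pi_E f = 0.
Proof.
move=> fR; have -> : 0 = \pi_E 0 by rewrite piE.
apply/eqP; rewrite -Quotient.idealrBE subr0; apply/asboolP.
exact: sub_gen_smallest fR.
Qed.

Lemma wedgeDl x y w : wedge (x + y) w = wedge x w + wedge y w.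
Proof.
apply/eqP; rewrite -subr_eq0 opprD addrA -!piB; apply/eqP/wedge_rel.
by left; left; exists x, y, w.
Qed.

Lemma wedgeDr w x y : wedge w (x + y) = wedge w x + wedge w y.
Proof.
apply/eqP; rewrite -subr_eq0 opprD addrA -!piB; apply/eqP/wedge_rel.
by left; right; exists x, y, w.
Qed.

Lemma wedgexx x : wedge x x = 0.
Proof. by apply/wedge_rel; right; exists x. Qed.

Let ffunMzE (g : {ffun A * A -> int}) (k : int) xy : (g *~ k) xy = g xy *~ k.
Proof. by case: k => k; rewrite /intmul ?ffunE ffunMnE. Qed.

Lemma pi_wedge (f : {ffun A * A -> int}) :
  \pi_E f = \sum_xy wedge xy.1 xy.2 *~ f xy.
Proof.
have fE : f = \sum_xy freegen xy.1 xy.2 *~ f xy.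
  apply/ffunP => xy; rewrite sum_ffunE (bigD1 xy) //= big1 ?addr0 => [|uv ne].
    by rewrite ffunMzE ffunE -surjective_pairing eqxx -mulrzr mul1r intz.
  by rewrite ffunMzE ffunE -surjective_pairing eq_sym (negPf ne) mul0rz.
rewrite [in LHS]fE raddf_sum; apply: eq_bigr => xy _; exact: raddfMz.
Qed.

Lemma wedge0l y : wedge 0 y = 0.
Proof. by apply: (addrI (wedge 0 y)); rewrite -wedgeDl !addr0. Qed.

Lemma wedge0r x : wedge x 0 = 0.
Proof. by apply: (addrI (wedge x 0)); rewrite -wedgeDr !addr0. Qed.

Lemma wedgeMnl x y k : wedge (x *+ k) y = wedge x y *+ k.
Proof. by elim: k => [|k IH]; rewrite ?wedge0l // !mulrS wedgeDl IH. Qed.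

Lemma wedgeMnr x y k : wedge x (y *+ k) = wedge x y *+ k.
Proof. by elim: k => [|k IH]; rewrite ?wedge0r // !mulrS wedgeDr IH. Qed.

Lemma wedgeC x y : wedge y x = - wedge x y.
Proof.
apply/eqP; rewrite -addr_eq0 addrC; apply/eqP.
by have := wedgexx (x + y); rewrite wedgeDl !wedgeDr !wedgexx add0r addr0.
Qed.

End Wedge.

Section TorsionWedge.
Variables (K : realType) (h p : nat) (h_gt0 : (0 < h)%N) (p_prime : prime p).
Local Notation m := (h * p)%N.
Local Notation A := (torsion (Zsquare m) h).

Let m_gt1 : (1 < m)%N.
Proof. by apply: leq_trans (prime_gt1 p_prime) _; rewrite leq_pmull. Qed.

Let pairMn (x : Zsquare m) k : x *+ k = (x.1 *+ k, x.2 *+ k).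
Proof. by elim: k => // k IH; rewrite !mulrS IH; case: x {IH}. Qed.

Let torsionE (x : Zsquare m) :
  (x \in @tors_pred (Zsquare m) h) = (p %| (x.1 : nat))%N && (p %| (x.2 : nat))%N.
Proof.
have mulhE (y : 'Z_m) : (y *+ h == 0) = (p %| (y : nat))%N.
  rewrite -{1}[y]natr_Zp -mulrnA -(inj_eq val_inj) /= val_Zp_nat //.
  by rewrite -/(dvdn _ _) [(y * h)%N]mulnC dvdn_pmul2l.
by rewrite inE pairMn -!mulhE.
Qed.

(** In Z / hp, the h-torsion is the set of multiples of p. *)
Lemma torsion_gens : exists t1 t2 : A, forall x, exists k l, x = t1 *+ k + t2 *+ l.
Proof.
have T1 : ((p%:R, 0) : Zsquare m) \in @tors_pred (Zsquare m) h.
  by rewrite torsionE /= val_Zp_nat // dvdn0 andbT /dvdn modn_dvdm ?dvdn_mull // modnn.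
have T2 : ((0, p%:R) : Zsquare m) \in @tors_pred (Zsquare m) h.
  by rewrite torsionE /= val_Zp_nat // dvdn0 /dvdn modn_dvdm ?dvdn_mull // modnn.
exists (Torsion T1), (Torsion T2) => -[x xT].
exists (x.1 %/ p)%N, (x.2 %/ p)%N.
have /andP[x1 x2] : (p %| (x.1 : nat))%N && (p %| (x.2 : nat))%N by rewrite -torsionE.
apply: val_inj; rewrite raddfD !raddfMn /= !pairMn /= !mul0rn -!mulrnA.
rewrite [(p * _)%N]mulnC [X in (_, _ *+ X)]mulnC !divnK // !natr_Zp.
by case: x {xT x1 x2} => x y; congr pair; rewrite /= ?addr0 ?add0r.
Qed.

Lemma torsionMn (x : A) : x *+ h = 0.
Proof. by apply: val_inj; rewrite raddfMn raddf0; apply/eqP; case: x. Qed.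

(** With two generators t1 and t2, every x /\ y is a multiple of t1 /\ t2. *)
Lemma wedge_torsion_cyclic : exists w : exterior_square A,
  forall x, exists2 k, (k < h)%N & x = w *+ k.
Proof.
have [t1 [t2 tP]] := torsion_gens; pose w := wedge t1 t2; exists w.
have wh : w *+ h = 0 by rewrite -wedgeMnl torsionMn wedge0l.
have wedge_mul x y : exists k, wedge x y = w *~ k.
  have [k [l ->]] := tP x; have [k' [l' ->]] := tP y.
  exists ((l' * k)%:Z - (k' * l)%:Z).
  rewrite wedgeDl !wedgeDr !wedgeMnl !wedgeMnr !wedgexx !mul0rn add0r addr0.
  by rewrite (wedgeC t1 t2) mulrzBr -!pmulrn !mulrnA !mulNrn.
move=> x; have [k ->] : exists k, x = w *~ k.
  rewrite -[x]reprK pi_wedge; elim/big_ind: _ => [|_ _ [k ->] [l ->]|xy _].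
  - by exists 0; rewrite mulr0z.
  - by exists (k + l); rewrite mulrzDr.
  - by have [k ->] := wedge_mul xy.1 xy.2; exists (k * repr x xy); rewrite mulrzA.
have h0 : (h%:Z != 0) by rewrite eqz_nat -lt0n.
exists `|(k %% h)%Z|%N; first by rewrite -ltz_nat gez0_abs ?modz_ge0 // ltz_pmod // ltz_nat.
rewrite [RHS]pmulrn gez0_abs ?modz_ge0 // [in LHS](divz_eq k h) mulrzDr mulrC mulrzA -pmulrn.
by rewrite wh mul0rz add0r.
Qed.

Lemma counting_wedge_torsion :
  (@counting _ K [set: exterior_square A] <= h%:R%:E)%E.
Proof.
have [w wP] := wedge_torsion_cyclic.
have T_sub : ([set: exterior_square A] `<=` (fun k => w *+ k) @` `I_h)%classic.
  by move=> x _; have [k kh ->] := wP x; exists k.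
rewrite /counting asboolT; last by apply: sub_finite_set T_sub _; exact: finite_image.
rewrite lee_fin ler_nat; apply: geq_card_fset_set.
exact: card_le_trans (subset_card_le T_sub) (card_image_le _ _).
Qed.
End TorsionWedge.

(** * Laws of the entries *)

Section DiscreteLaw.
Import numFieldNormedType.Exports.
Local Open Scope classical_set_scope.
Variables (K : realType) (d : measure_display) (Omega : measurableType d).
Variable P : probability Omega K.

Lemma discrete_rv_preimage (V : finType) (Y : Omega -> V) (S : set V) :
  discrete_rv Y -> measurable (Y @^-1` S).
Proof.
move=> Y_rv; rewrite (_ : _ @^-1` _ = \bigcup_(v in S) Y @^-1` [set v]).
  by apply: fin_bigcup_measurable => // v _; exact: Y_rv.
apply/seteqP; split=> [w Sw|w [v Sv e]]; first by exists (Y w).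
by rewrite /preimage /= e.
Qed.

Lemma discrete_rv_comp (V W : finType) (Y : Omega -> V) (g : V -> W) :
  discrete_rv Y -> discrete_rv (g \o Y).
Proof. by move=> Y_rv v; rewrite comp_preimage; exact: discrete_rv_preimage. Qed.

Lemma expectation_discrete (V : finType) (Y : Omega -> V) (F : V -> K) :
  discrete_rv Y -> (forall v, 0 <= F v) ->
  (\int[P]_w (F (Y w))%:E = (\sum_v fine (P (Y @^-1` [set v])) * F v)%:E)%E.
Proof.
move=> Y_rv F0.
have -> : (fun w => (F (Y w))%:E) =
    (fun w => \sum_v (F v)%:E * (\1_(Y @^-1` [set v]) w)%:E)%E.
  apply/funext => w; rewrite (bigD1 (Y w)) //= big1 ?adde0 => [|v ne].
    by rewrite indicE mem_set // mule1.
  by rewrite indicE memNset ?mule0 // => /= e; rewrite e eqxx in ne.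
have m_ind v : measurable_fun setT (EFin \o (\1_(Y @^-1` [set v]) : Omega -> K)).
  by apply/measurable_EFinP; apply: measurable_indic; exact: Y_rv.
rewrite ge0_integral_sum //; last 2 first.
- by move=> v; exact: (measurable_funeM (F v)%:E (m_ind v)).
- by move=> v w _; rewrite mule_ge0 // lee_fin.
rewrite -sumEFin; apply: eq_bigr => v _.
rewrite ge0_integralZl_EFin //; last exact: m_ind.
rewrite integral_indic // setIT.
by rewrite EFinM muleC fineK // fin_num_measure //; exact: Y_rv.
Qed.

Lemma prob_discrete (V : finType) (Y : Omega -> V) (S : pred V) :
  discrete_rv Y ->
  P [set w | S (Y w)] = (\sum_(v | S v) fine (P (Y @^-1` [set v])))%:E.
Proof.
move=> Y_rv; have mS : measurable [set w | S (Y w)] by exact: (discrete_rv_preimage S Y_rv).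
rewrite -[LHS](_ : P ([set w | S (Y w)] `&` setT) = _); last by rewrite setIT.
rewrite -(integral_indic P measurableT mS).
under eq_integral => w _.
  rewrite indicE (_ : (w \in _) = S (Y w)); last first.
    by apply/idP/idP => [/set_mem|h] //; exact/mem_set.
  over.
rewrite (expectation_discrete (F := fun v => (S v)%:R)) //.
congr EFin; rewrite [RHS]big_mkcond; apply: eq_bigr => v _.
by case: (S v); rewrite ?mulr1 ?mulr0.
Qed.

Lemma sum_prob_discrete (V : finType) (Y : Omega -> V) :
  discrete_rv Y -> \sum_v fine (P (Y @^-1` [set v])) = 1.
Proof.
move=> Y_rv; have := prob_discrete xpredT Y_rv.
by rewrite (_ : [set w | _] = setT) ?probability_setT => [[<-]|]; last by apply/seteqP.
Qed.

End DiscreteLaw.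

Lemma sub_maximal_ideal (R : finComNzRingType) (J : {set R}) :
  idealr_closed J -> exists2 I, maximal_ideal I & J \subset I.
Proof.
move=> Jid; pose Q : pred {set R} := fun S => `[< idealr_closed S >].
have QJ : Q J by exact/asboolP.
have [I /maxsetP[/asboolP Iid Imax] JI] := maxset_exists QJ.
exists I => //; split=> // J' J'id IJ'.
by apply: Imax => //; exact/asboolP.
Qed.

(** The residues killed by b modulo m form a proper ideal, hence lie in a maximal one,
    and balancedness bounds the probability of each of its cosets. *)
Lemma balanced_red (K : realType) (d : measure_display) (Omega : measurableType d)
    (P : probability Omega K) (a m : nat) (eps : K) (N : Omega -> 'Z_a)
    (b : 'Z_m) (y : 'Z_a) :
  (0 < a)%N -> (1 < m)%N -> (m %| a)%N -> discrete_rv N ->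
  balanced P eps N -> b != 0 ->
  \sum_(x | b * red m x == b * red m y) fine (P (N @^-1` [set x])%classic) <= 1 - eps.
Proof.
move=> a0 m1 ma N_rv N_bal b0.
have Jid : idealr_closed [set x : 'Z_a | b * red m x == 0]%SET.
  split; rewrite ?inE ?red0 ?red1 ?mulr0 ?mulr1 // => c u v.
  by rewrite !inE redD // redM // mulrDr mulrCA => /eqP-> /eqP->; rewrite mulr0 addr0.
have [I Imax JI] := sub_maximal_ideal Jid.
rewrite -lee_fin -(prob_discrete P (fun x => b * red m x == b * red m y)) //.
apply: le_trans (N_bal I y Imax); apply: le_measure; rewrite ?inE.
- exact: (discrete_rv_preimage (fun x => b * red m x == b * red m y) N_rv).
- exact: (discrete_rv_preimage (fun x => (x - y)%R \in I) N_rv).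
move=> w /= e; apply: (fintype.subsetP JI).
by rewrite inE redD // redN // mulrDr mulrN subr_eq0.
Qed.

Section UpperEntries.
Local Open Scope classical_set_scope.
Variables (K : realType) (a n : nat) (d : measure_display) (Omega : measurableType d).
Variables (P : probability Omega K) (C : 'M['Z_a]_n) (X : Omega -> 'M['Z_a]_n).
Hypothesis X_rv : discrete_rv X.
Hypothesis X_Csym : forall w, Csymmetric C (X w).
Hypothesis X_indep : mutually_independent P (upper_indices n)
  (fun (ij : 'I_n * 'I_n) (w : Omega) => (X w) ij.1 ij.2).

(** The lower indices get a law concentrated at 0, so that the joint law of the upper
    entries becomes a product over all pairs of indices. *)
Definition entry_law (k : 'I_n * 'I_n) (x : 'Z_a) : K :=
  if (k.1 <= k.2)%N then fine (P ((fun w => X w k.1 k.2) @^-1` [set x]))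
  else (x == 0)%:R.

Lemma entry_rv i j : discrete_rv (fun w => X w i j).
Proof. exact: (discrete_rv_comp (fun M : 'M['Z_a]_n => M i j) X_rv). Qed.

Lemma entry_law_ge0 k x : 0 <= entry_law k x.
Proof. by rewrite /entry_law; case: ifP => // _; rewrite fine_ge0. Qed.

Lemma sum_entry_law k : \sum_x entry_law k x = 1.
Proof.
rewrite /entry_law; case: (k.1 <= k.2)%N.
  exact: (sum_prob_discrete P (entry_rv k.1 k.2)).
by rewrite (bigD1 0) //= big1 ?addr0 // => x /negPf ->.
Qed.

Definition upper_part (M : 'M['Z_a]_n) : {ffun 'I_n * 'I_n -> 'Z_a} :=
  [ffun k : 'I_n * 'I_n => if (k.1 <= k.2)%N then M k.1 k.2 else 0].

Lemma symfill_upper_part M : Csymmetric C M -> symfill C (upper_part M) = M.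
Proof.
move=> MC; apply/matrixP => i j; rewrite !mxE !ffunE /=; case: leqP => // ltji.
by rewrite ltnW // -MC !mxE addrCA subrr addr0.
Qed.

(** Independence of the upper entries; if g does not vanish below the diagonal, both
    sides are 0. *)
Lemma prob_upper_part g :
  fine (P ((upper_part \o X) @^-1` [set g])) = \prod_k entry_law k (g k).
Proof.
have [|no_low] := boolP [exists k : 'I_n * 'I_n, (k.2 < k.1)%N && (g k != 0)].
  case/existsP => k /andP[klow gk]; rewrite (bigD1 k) //= /entry_law leqNgt klow /=.
  rewrite (negPf gk) mul0r (_ : _ @^-1` _ = set0) ?measure0 //.
  apply/seteqP; split=> // w /= e; by move: gk; rewrite -e ffunE leqNgt klow.
have low0 (k : 'I_n * 'I_n) : ~~ ((k.2 < k.1)%N && (g k != 0)).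
  by move: no_low; rewrite negb_exists => /forallP/(_ k).
rewrite (_ : _ @^-1` _ =
    [set w | forall k, k \in upper_indices n -> X w k.1 k.2 \in [set g k]%SET]); last first.
  apply/seteqP; split=> w /= h.
    by move=> k; rewrite inE => k_up; rewrite inE -h ffunE k_up.
  apply/ffunP => k; rewrite ffunE; case: leqP => k_up.
    by apply/eqP; rewrite -finset.in_set1; apply: h; rewrite inE.
  by apply/eqP; rewrite eq_sym; move: (low0 k); rewrite k_up /= negbK.
rewrite (X_indep (fun k => [set g k]%SET)) //.
rewrite (eq_bigr (fun k => (entry_law k (g k))%:E)) => [|k]; last first.
  rewrite inE => k_up; rewrite /entry_law k_up fineK; last first.
    by rewrite fin_num_measure //; exact: entry_rv.
  congr (P _); apply/seteqP; split=> w /=; rewrite finset.in_set1; first by move/eqP.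
  by move=> ->.
rewrite prodEFin /= big_mkcond; apply: eq_bigr => k _; rewrite inE.
case: ifPn => //; rewrite -ltnNge => klow; move: (low0 k).
by rewrite klow /= negbK => /eqP ->; rewrite /entry_law leqNgt klow eqxx.
Qed.

Lemma expectation_symfill (F : 'M['Z_a]_n -> K) : (forall M, 0 <= F M) ->
  'E_P[fun w => F (X w)]%E =
  (\sum_(g : {ffun 'I_n * 'I_n -> 'Z_a}) (\prod_k entry_law k (g k)) * F (symfill C g))%:E.
Proof.
move=> F0; rewrite unlock.
have -> : (fun w => (F (X w))%:E) = (fun w => (F (symfill C ((upper_part \o X) w)))%:E).
  by apply/funext => w; rewrite /= symfill_upper_part.
rewrite (expectation_discrete P (Y := upper_part \o X) (F := fun g => F (symfill C g))) //.
  by congr EFin; apply: eq_bigr => g _; rewrite prob_upper_part.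
exact: discrete_rv_comp.
Qed.

End UpperEntries.

(** * Asymptotics *)

Section Asymptotics.
Import numFieldNormedType.Exports.
Variable K : realType.
Implicit Types (x y eta : K).

Lemma expr_eventually_le x eta : 0 <= x < 1 -> 0 < eta ->
  exists N : nat, forall k, (N <= k)%N -> x ^+ k <= eta.
Proof.
move=> /andP[x0 x1] eta0.
have /cvg_expr/cvgrPdist_le/(_ _ eta0)[N _ hN] : `|x| < 1 by rewrite ger0_norm.
exists N => k /hN /=; rewrite sub0r normrN ger0_norm //; exact: exprn_ge0.
Qed.

(** The k + 1 first terms of the geometric series are all at least y ^ k. *)
Lemma mulrn_expr_le y k : 0 <= y < 1 -> k.+1%:R * y ^+ k <= (1 - y)^-1.
Proof.
move=> /andP[y0 y1]; have y1' : 0 < 1 - y by rewrite subr_gt0.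
rewrite -[leRHS]mul1r ler_pdivlMr //.
apply: (@le_trans _ _ ((\sum_(i < k.+1) y ^+ i) * (1 - y))).
  rewrite ler_wpM2r ?(ltW y1') // mulr_natl -[k.+1 in leLHS]card_ord -sumr_const.
  by apply: ler_sum => i _; rewrite ler_wiXn2l ?(ltW y1) // -ltnS ltn_ord.
by rewrite mulrC -opprB mulNr -subrX1 opprB gerBl exprn_ge0.
Qed.

(** Writing x = y ^ 2, one factor y ^ q with q = n / A absorbs n and the other one tends
    to 0. *)
Lemma mulrn_expr_divn_eventually_le x eta A : 0 <= x < 1 -> 0 < eta -> (0 < A)%N ->
  exists N : nat, forall n, (N <= n)%N -> n%:R * x ^+ (n %/ A) <= eta.
Proof.
move=> /andP[x0 x1] eta0 A0; pose y := Num.sqrt x.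
have y01 : 0 <= y < 1 by rewrite sqrtr_ge0 -sqrtr1 ltr_sqrt.
have /andP[y0 y1] := y01.
have xE : x = y ^+ 2 by rewrite sqr_sqrtr.
have AK : 0 < A%:R :> K by rewrite ltr0n.
have d0 : 0 < eta * (1 - y) / A%:R by rewrite divr_gt0 // mulr_gt0 // subr_gt0.
have [N hN] := expr_eventually_le y01 d0.
exists (N * A)%N => n Nn; set q := (n %/ A)%N.
have Nq : (N <= q)%N by rewrite leq_divRL.
have nq : n%:R <= A%:R * q.+1%:R :> K.
  by rewrite -natrM ler_nat mulnC ltnW // ltn_ceil.
apply: (@le_trans _ _ (A%:R * (q.+1%:R * y ^+ q) * y ^+ q)).
  rewrite xE -exprM mul2n -addnn exprD !mulrA ler_wpM2r ?exprn_ge0 //.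
  by rewrite ler_wpM2r ?exprn_ge0.
apply: (@le_trans _ _ (A%:R * (1 - y)^-1 * (eta * (1 - y) / A%:R))).
  apply: ler_pM; [|exact: exprn_ge0| |exact: hN].
    by rewrite !mulr_ge0 // exprn_ge0.
  by rewrite ler_pM2l // mulrn_expr_le.
rewrite le_eqVlt; apply/orP; left; apply/eqP; field.
by rewrite subr_eq0 !lt0r_neq0 //= gt_eqF.
Qed.

Lemma expr1D_le x n : 0 <= x -> 2 * n%:R * x <= 1 -> (1 + x) ^+ n <= 1 + 2 * n%:R * x.
Proof.
move=> x0; elim: n => [|n IH] h; first by rewrite expr0 mulr0 mul0r addr0.
have h' : 2 * n%:R * x <= 1.
  by apply: le_trans h; rewrite ler_wpM2r // ler_wpM2l // ler_nat.
rewrite exprSr; apply: le_trans (ler_wpM2r _ (IH h')) _; first by rewrite addr_ge0.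
have : 2 * n%:R * x * x <= x by rewrite ler_piMl.
by rewrite -natr1; nra.
Qed.

Lemma fourier_error_ge0 m n (sigma : K) s t :
  0 <= sigma -> 0 <= fourier_error m n sigma s t.
Proof.
move=> s0; apply: mulr_ge0 => //; apply: addr_ge0; last exact: exprn_ge0.
by rewrite subr_ge0 exprn_ege1 // lerDl mulr_ge0 ?exprn_ge0.
Qed.

(** Both s and t grow linearly in n, so n sigma ^ s tends to 0 and the n-th power in
    [fourier_error] tends to 1. *)
Lemma fourier_error_eventually_le (m T : nat) (sigma eta : K) :
  0 <= sigma < 1 -> (0 < m)%N -> (0 < T)%N -> 0 < eta ->
  exists N : nat, forall n, (N <= n)%N ->
    fourier_error m n sigma (n %/ T %/ m ^ 2)%N (n %/ T)%N <= eta.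
Proof.
move=> s01 m0 T0 eta0; have /andP[s0 s1] := s01.
pose c := (m ^ 4)%:R * (2 * (m ^ 2)%:R + 1) : K.
have m2 : 0 < (m ^ 2)%:R :> K by rewrite ltr0n expn_gt0 m0.
have m4 : 0 < (m ^ 4)%:R :> K by rewrite ltr0n expn_gt0 m0.
have c0 : 0 < c by rewrite mulr_gt0 // addr_gt0 // mulr_gt0.
pose eta' := Num.min (eta / c) (2 * (m ^ 2)%:R)^-1.
have eta'0 : 0 < eta' by rewrite lt_min divr_gt0 // invr_gt0 mulr_gt0.
have A0 : (0 < T * m ^ 2 * 2)%N by rewrite !muln_gt0 T0 m0.
have [N1 h1] := mulrn_expr_divn_eventually_le s01 eta'0 A0.
have [N2 h2] := expr_eventually_le s01 eta'0.
exists (maxn N1 (N2 * T)) => n; rewrite geq_max => /andP[n1 n2].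
set s := (n %/ T %/ m ^ 2)%N; set t := (n %/ T)%N.
have st : sigma ^+ t <= eta' by apply: h2; rewrite leq_divRL.
have ss : n%:R * sigma ^+ s.-1 <= eta'.
  apply: le_trans (h1 n n1); rewrite ler_wpM2l // ler_wiXn2l ?(ltW s1) //.
  by rewrite divnMA divnMA -/t -/s; clearbody s; lia.
have e1 : eta' * (2 * (m ^ 2)%:R) <= 1.
  by rewrite -ler_pdivlMr ?mulr_gt0 // mul1r ge_min lexx orbT.
have e2 : c * eta' <= eta by rewrite mulrC -ler_pdivlMr // ge_min lexx.
have x0 : 0 <= (m ^ 2)%:R * sigma ^+ s.-1 by rewrite mulr_ge0 ?exprn_ge0.
have nx : 2 * n%:R * ((m ^ 2)%:R * sigma ^+ s.-1) <= 2 * (m ^ 2)%:R * eta'.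
  rewrite [leLHS](_ : _ = 2 * (m ^ 2)%:R * (n%:R * sigma ^+ s.-1)); last by ring.
  by rewrite ler_pM2l ?mulr_gt0.
have pw : (1 + (m ^ 2)%:R * sigma ^+ s.-1) ^+ n <= 1 + 2 * (m ^ 2)%:R * eta'.
  apply: le_trans (expr1D_le x0 _) _; last by rewrite lerD2l.
  by apply: le_trans nx _; rewrite mulrC.
apply: le_trans e2; rewrite /c /fourier_error -mulrA ler_pM2l // mulrDl mul1r.
by rewrite lerD // lerBlDl.
Qed.

Lemma exists_expr_lt_half (r : K) : 0 <= r < 1 -> exists2 T : nat, (0 < T)%N & 2 * r ^+ T < 1.
Proof.
move=> r01; have e0 : 0 < 4^-1 :> K by rewrite invr_gt0.
have [N hN] := expr_eventually_le r01 e0.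
by exists N.+1 => //; have := hN N.+1 (leqnSn N); lra.
Qed.

Lemma limn_einf_ge (u : (\bar K)^nat) (l : \bar K) (N : nat) :
  (forall n, (N <= n)%N -> (l <= u n)%E) -> (l <= limn_einf u)%E.
Proof.
move=> lu; rewrite limn_einf_lim; apply: lime_ge; first exact: is_cvg_einfs.
exists N => // n /= Nn; apply: le_ereal_inf_tmp => _ [k /= nk <-].
by apply: lu; exact: leq_trans nk.
Qed.

End Asymptotics.

Local Open Scope classical_set_scope.

(** * The moment of the cokernel *)

(** The moment is at least the sum of P (f X = 0) over the rich f with [cross C f] = 0.
    The last factor bounds the proportion of these f from below, as the proportion
    of all f with [cross C f] = 0 minus that of the f that are not rich. *)
Lemma expectation_Sur_ge (K : realType) (a h p : nat) (eps : K)
    (a_gt0 : (0 < a)%N) (h_gt0 : (0 < h)%N) (h_dvd_a : (h %| a)%N)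
    (eps_gt0 : 0 < eps) (p_prime : prime p) (p_dvd : (p %| a %/ h)%N) :
  exists2 sigma : K, 0 <= sigma < 1 &
  forall (n B t s : nat) (d : measure_display) (Omega : measurableType d)
    (P : probability Omega K) (C : 'M['Z_a]_n) (X : Omega -> 'M['Z_a]_n),
  alternating_mx C ->
  (forall i j, exists b, C i j = h%:R * b) ->
  discrete_rv X -> (forall w, Csymmetric C (X w)) ->
  mutually_independent P (upper_indices n)
    (fun (ij : 'I_n * 'I_n) (w : Omega) => (X w) ij.1 ij.2) ->
  (forall i j : 'I_n, (i <= j)%N -> balanced P eps (fun w => (X w) i j)) ->
  (\rank (reduce_mx p (divmx h C)) <= B)%N ->
  (0 < t)%N -> ((h * p) ^ 2 * s <= t)%N ->
  fourier_error (h * p) n sigma s t <= (h * p)%:R ->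
  ((((h * p)%:R - fourier_error (h * p) n sigma s t) *
    (p%:R^-1 + p%:R ^- B * (1 - p%:R^-1) -
     2 * (2 ^+ t * (1 - (2 * ((h * p) ^ 2)%:R)^-1) ^+ n)))%:E <=
   'E_P[fun w => #|Sur (coker (X w)) (Zsquare (h * p))|%:R])%E.
Proof.
set m := (h * p)%N.
have m_gt1 : (1 < m)%N := hp_gt1 h_gt0 p_prime.
have m_dvd : (m %| a)%N := hp_dvd h_dvd_a p_dvd.
have m_gt0 : (0 < m)%N by exact: ltnW.
have [z z_prim] := prim_root_exists K[i]%C (ltnW m_gt1).
have [sigma sigma01 char_le] := balanced_zchar m_gt1 z_prim eps_gt0.
exists sigma => // n B t s d Omega P C X [CT C0] C_div X_rv X_Csym X_indep X_bal.
move=> rankB t0 st err_le.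
have M0 : 0 < ((m ^ 2) ^ n)%:R :> K.
  by rewrite ltr0n expn_gt0 expn_gt0 m_gt0.
have sigma01' : 0 <= sigma <= 1 by have /andP[-> /ltW ->] := sigma01.
rewrite (expectation_symfill X_rv X_Csym X_indep
  (F := fun M => #|Sur (coker M) (Zsquare m)|%:R)) // lee_fin.
pose wt (g : {ffun 'I_n * 'I_n -> 'Z_a}) := \prod_k entry_law P X k (g k).
have wt0 g : 0 <= wt g by apply: prodr_ge0 => k _; exact: entry_law_ge0.
pose prob_kills (f : {ffun 'I_n -> 'Z_m * 'Z_m}) : K := \sum_(g | kills f (symfill C g)) wt g.
pose F := [set f : {ffun 'I_n -> 'Z_m * 'Z_m} | rich t f && (cross C f == 0)]%SET.
have E_ge : \sum_(f in F) prob_kills f <=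
    \sum_g wt g * #|Sur (coker (symfill C g)) (Zsquare m)|%:R.
  rewrite /prob_kills (exchange_big_dep xpredT) //=; apply: ler_sum => g _.
  rewrite sumr_const -[leLHS]mulr_natr ler_wpM2l // ler_nat.
  apply: leq_trans (card_kills_le_Sur a_gt0 m_gt1 m_dvd (symfill C g) t0).
  apply: subset_leq_card; apply/fintype.subsetP => f.
  by rewrite [in X in _ -> X]inE => /andP[+ ->]; rewrite inE andbT => /andP[].
apply: le_trans E_ge.
have kills_ge f : f \in F ->
    (m%:R - fourier_error m n sigma s t) / ((m ^ 2) ^ n)%:R <= prob_kills f.
  rewrite inE => /andP[f_rich /eqP f_cross].
  rewrite (ler_pdivrMr _ _ M0) mulrC.
  apply: (kills_lower a_gt0 m_gt1 m_dvd z_prim CT C0 sigma01') => //.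
    by move=> k; exact: sum_entry_law.
  move=> k b k_up b0; apply: (char_le _ (entry_law P X k) (fun x => b * red m x)).
  - by move=> x; exact: entry_law_ge0.
  - exact: sum_entry_law.
  move=> y; under eq_bigr do rewrite /entry_law k_up.
  apply: (balanced_red (N := fun w => X w k.1 k.2)) => //; first exact: entry_rv.
  exact: X_bal.
apply: le_trans (ler_sum _ kills_ge); rewrite sumr_const -[leRHS]mulr_natr.
rewrite -mulrA ler_wpM2l ?subr_ge0 //.
rewrite [leRHS]mulrC (ler_pdivlMr _ _ M0).
have F_card : #|[set f : {ffun 'I_n -> 'Z_m * 'Z_m} | cross C f == 0%R]%SET|%:R <=
    #|F|%:R + #|[set f : {ffun 'I_n -> 'Z_m * 'Z_m} | ~~ rich t f]%SET|%:R :> K.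
  rewrite -natrD ler_nat; apply: leq_trans (leq_card_setU _ _).
  apply: subset_leq_card; apply/fintype.subsetP => f; rewrite !inE => ->.
  by rewrite andbT orbN.
have := card_cross K a_gt0 h_gt0 h_dvd_a p_prime p_dvd C_div rankB.
have := card_not_rich K n m_gt1 t.
rewrite -/m => notrich crossed.
have m2E : ((m ^ 2)%:R - 2^-1) ^+ n =
    ((m ^ 2) ^ n)%:R * (1 - (2 * (m ^ 2)%:R)^-1) ^+ n :> K.
  rewrite [X in _ = X * _]natrX -exprMn; congr (_ ^+ _).
  by field; rewrite pnatr_eq0 -lt0n.
rewrite m2E in notrich; set M := ((m ^ 2) ^ n)%:R in notrich crossed *.
by move: F_card notrich crossed; lra.
Qed.

Theorem theorem5p4 (K : realType) (a h p : nat) (eps : K)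
    (C : forall n : nat, 'M['Z_a]_n)
    (d : nat -> measure_display)
    (Omega : forall n : nat, measurableType (d n))
    (P : forall n : nat, probability (Omega n) K)
    (X : forall n : nat, Omega n -> 'M['Z_a]_n)
    (a_gt0 : (0 < a)%N) (h_gt0 : (0 < h)%N) (h_dvd_a : (h %| a)%N)
    (eps_gt0 : 0 < eps)
    (C_alt : forall n, (0 < n)%N -> alternating_mx (C n))
    (C_div : forall n, (0 < n)%N ->
       forall i j : 'I_n, exists b : 'Z_a, (C n) i j = h%:R * b)
    (X_rv : forall n, (0 < n)%N -> discrete_rv (@X n))
    (X_Csym : forall n, (0 < n)%N -> forall w, Csymmetric (C n) (X n w))
    (X_indep : forall n, (0 < n)%N ->
       mutually_independent (P n) (upper_indices n)
         (fun (ij : 'I_n * 'I_n) (w : Omega n) => (X n w) ij.1 ij.2))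
    (X_bal : forall n, (0 < n)%N -> forall i j : 'I_n, (i <= j)%N ->
       balanced (P n) eps (fun w => (X n w) i j))
    (p_prime : prime p) (p_dvd : (p %| a %/ h)%N)
    (rank_bounded : exists B : nat, forall n, (0 < n)%N ->
       (\rank (reduce_mx p (divmx h (C n))) <= B)%N) :
  (@counting _ K [set: exterior_square (torsion (Zsquare (h * p)) h)] <
   limn_einf (fun n =>
     'E_(P n)[fun w => #|Sur (coker (X n w)) (Zsquare (h * p))|%:R]))%E.
Proof.
have [B rankB] := rank_bounded.
have [sigma sigma01 E_ge] :=
  expectation_Sur_ge a_gt0 h_gt0 h_dvd_a eps_gt0 p_prime p_dvd.
set m := (h * p)%N in E_ge *.
have m_gt1 : (1 < m)%N := hp_gt1 h_gt0 p_prime.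
have p2 : 2 <= p%:R :> K by rewrite ler_nat prime_gt1.
have hK : 1 <= h%:R :> K by rewrite ler1n.
have mK : m%:R = h%:R * p%:R :> K by rewrite natrM.
have p0 : 0 < p%:R :> K by lra.
have m0 : 0 < m%:R :> K by rewrite ltr0n ltnW.
pose q : K := p%:R ^- B.
have q01 : 0 < q <= 1.
  by rewrite invr_gt0 exprn_gt0 //= invf_le1 ?exprn_gt0 // exprn_ege1 //; lra.
have /andP[q0 q1] := q01.
(* theta bounds from below the proportion of the maps f with f1 C f2^T = 0, and the
   main term m theta exceeds h by c. *)
pose theta : K := p%:R^-1 + q * (1 - p%:R^-1).
have pV : 0 < (p%:R^-1 : K) <= 2^-1 by rewrite invr_gt0 p0 lef_pV2 // posrE; lra.
have theta1 : theta <= 1 by rewrite /theta; move: pV => /andP[]; nra.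
have theta0 : 0 < theta by rewrite /theta; move: pV => /andP[]; nra.
pose c : K := h%:R * (p%:R - 1) * q.
have c0 : 0 < c by rewrite !mulr_gt0 //; lra.
have mtheta : m%:R * theta = h%:R + c.
  by rewrite mK /theta /c; field; exact: lt0r_neq0.
pose r : K := 1 - (2 * (m ^ 2)%:R)^-1.
have r01 : 0 <= r < 1.
  have m2 : 1 <= (m ^ 2)%:R :> K by rewrite ler1n expn_gt0 ltnW.
  have v0 : 0 < (2 * (m ^ 2)%:R)^-1 :> K by rewrite invr_gt0; lra.
  have v1 : (2 * (m ^ 2)%:R)^-1 <= 1 :> K by rewrite invf_le1; lra.
  by rewrite /r; apply/andP; split; lra.
(* T is chosen so that requiring n / T occurrences of each basis vector still excludes
   an exponentially small proportion of the maps. *)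
have [T T0 rT] := exists_expr_lt_half r01.
have /andP[r0 r1] := r01.
have b01 : 0 <= 2 * r ^+ T < 1 by rewrite rT mulr_ge0 // exprn_ge0.
have eta0 : 0 < Num.min (c / 4) m%:R by rewrite lt_min m0 divr_gt0.
have eta1 : 0 < c / (8 * m%:R) by rewrite divr_gt0 // mulr_gt0.
have [N1 err_le] := fourier_error_eventually_le sigma01 (ltnW m_gt1) T0 eta0.
have [N2 bad_le] := expr_eventually_le b01 eta1.
apply: (@lt_le_trans _ _ (h%:R + c / 2)%:E).
  apply: le_lt_trans (counting_wedge_torsion K h_gt0 p_prime) _.
  by rewrite lte_fin ltrDl divr_gt0.
apply: (@limn_einf_ge _ _ _ (maxn (maxn N1 (N2 * T)) T)) => n.
rewrite !geq_max => /andP[/andP[n1 n2] n3].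
have n0 : (0 < n)%N by exact: leq_trans n3.
have t0 : (0 < n %/ T)%N by rewrite divn_gt0.
have := err_le n n1; set err := fourier_error _ _ _ _ _ => err_n.
have /andP[err_c err_m] : (err <= c / 4) && (err <= m%:R).
  by move: err_n; rewrite le_min.
apply: le_trans (E_ge n B _ _ _ _ _ _ _ (C_alt n n0) (C_div n n0) (X_rv n n0)
  (X_Csym n n0) (X_indep n n0) (X_bal n n0) (rankB n n0) t0 _ err_m); last first.
  by rewrite mulnC leq_trunc_div.
rewrite -/err -/q -/theta -/r lee_fin.
set bad := 2 ^+ _ * r ^+ n.
have bad0 : 0 <= bad by rewrite mulr_ge0 ?exprn_ge0.
have bad_c : bad * (8 * m%:R) <= c.
  rewrite -ler_pdivlMr ?mulr_gt0 //; apply: le_trans (bad_le (n %/ T)%N _); last first.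
    by rewrite leq_divRL.
  rewrite exprMn -exprM ler_wpM2l ?exprn_ge0 // ler_wiXn2l ?(ltW r1) //.
  by rewrite mulnC leq_trunc_div.
have err0 : 0 <= err.
  by have /andP[s0 _] := sigma01; exact: fourier_error_ge0.
have errtheta : err * theta <= err by rewrite ler_piMr.
have errbad : 0 <= err * bad by rewrite mulr_ge0.
rewrite [leRHS](_ : _ = (h%:R + c) - err * theta - 2 * (bad * m%:R) + 2 * (err * bad)).
  by lra.
by rewrite -mtheta; ring.
Qed.
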